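(* Let $\mathcal C$ be a braided monoidal category with a class $\mathcal Q$ of regular epimorphisms satisfying the standing assumptions, and let $\mathcal M$ be the induced monoidal category (both described in the context). For an object $(A,m)$ of $\mathcal M$, and for morphisms $t_1,t_2\colon A^2\to A^2$ and $e\colon A\to I$ in $\mathcal C$, put $$d_1 := m1\,.\,1c\,.\,t_11\,.\,1c^{-1}\colon A^3\to A^2,\qquad d_2 := 1m\,.\,c1\,.\,1t_2\,.\,c^{-1}1\colon A^3\to A^2 .$$ The following assertions are equivalent. (i) There is a comonoid in $\mathcal M$ on the object $(A,m)$ whose counit is the $\mathbb M$-morphism $A\nrightarrow I$ with components $(e\colon A\to I,\ e\colon A\to I)$ and whose comultiplication is the $\mathbb M$-morphism $A\nrightarrow A^2$ with components $(d_1,d_2)$. (In particular, these pairs are morphisms of $\mathcal M$.) (ii) $(A,t_1,t_2,e)$ is a multiplier bimonoid in $\mathcal C$ such that - the resulting multiplication $e1.t_1=1e.t_2$ is equal to the given one $m\colon A^2\to A$, - the counit $e$, and the morphisms $d_1$ and $d_2$, lie in $\mathcal Q$.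
   Context: Conventions. $\mathcal C$ is a braided monoidal category with monoidal unit $I$ and braiding $c$. The monoidal product is written by juxtaposition (of objects and of morphisms), associativity and unit isomorphisms are suppressed, $A^n$ is the $n$-fold monoidal power, $1$ denotes an identity morphism, and $g.f$ is the composite of $f\colon A\to B$ and $g\colon B\to C$. Standing assumptions on $\mathcal Q$. $\mathcal Q$ is a class of regular epimorphisms in $\mathcal C$ which contains the isomorphisms, is closed under composition and monoidal product, and is right-cancellative: if $s\colon A\to B$ and $t.s\colon A\to C$ are in $\mathcal Q$ then so is $t\colon B\to C$. Moreover each $q\in\mathcal Q$ is the coequalizer of some pair of morphisms, chosen so that this coequalizer is preserved by taking the monoidal product with any object. Semigroups. A semigroup is a pair $(A,m)$ with $m\colon A^2\to A$ satisfying $m.m1=m.1m$. It is non-degenerate if for all objects $X,Y$ both maps $\mathcal C(X,YA)\to\mathcal C(XA,YA)$, $f\mapsto 1m.f1$, and $\mathcal C(X,AY)\to\mathcal C(AX,AY)$, $g\mapsto m1.1g$, are injective. $\mathbb M$-morphisms. For an object $A$ and a non-degenerate semigroup $B$, an $\mathbb M$-morphism $f\colon A\nrightarrow B$ is a pair of morphisms (components) $f_1\colon AB\to B$, $f_2\colon BA\to B$ with $m.1f_1=m.f_21\colon BAB\to B$. It is dense if $f_1,f_2\in\mathcal Q$. If $A$ is a semigroup, $f$ is multiplicative if $f_1.1f_1=f_1.m1\colon A^2B\to B$ and $f_2.f_21=f_2.1m\colon BA^2\to B$. The category $\mathcal M$. Objects: non-degenerate semigroups whose multiplication lies in $\mathcal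 Q$. Morphisms: dense multiplicative $\mathbb M$-morphisms. The composite $g\bullet f\colon A\nrightarrow C$ of $f\colon A\nrightarrow B$ and $g\colon B\nrightarrow C$ is the unique $\mathbb M$-morphism with $(g\bullet f)_1.1g_1=g_1.f_11\colon ABC\to C$ and $(g\bullet f)_2.g_21=g_2.1f_2\colon CBA\to C$. The identity on $A$ has both components equal to $m$. The category $\mathcal M$ is monoidal: the product of semigroups $A,B$ is $AB$ with multiplication $mm.1c1\colon (AB)^2\to AB$; the unit is $I$ with its trivial multiplication; the product of $f\colon A\nrightarrow B$ and $f'\colon A'\nrightarrow B'$ has components $f_1f'_1.1c1\colon AA'BB'\to BB'$ and $f_2f'_2.1c1\colon BB'AA'\to BB'$. The associativity and unit isomorphisms are induced from those of $\mathcal C$, where a semigroup isomorphism $f\colon A\to B$ induces the $\mathbb M$-morphism with components $m.f1$ and $m.1f$. Multiplier bimonoid. A multiplier bimonoid in $\mathcal C$ is an object $A$ with morphisms $t_1,t_2\colon A^2\to A^2$ and $e\colon A\to I$ such that: - $t_11.1c.t_11.1c^{-1}.1t_1=1t_1.t_11$ and $1e.t_1=1e$ (that is, $t_1$ is a fusion morphism with counit $e$); - symmetrically, $1t_2.c1.1t_2.c^{-1}1.t_21=t_21.1t_2$ and $e1.t_2=e1$; - $t_21.1t_1=1t_1.t_21\colon A^3\to A^3$; - $e1.t_1=1e.t_2\colon A^2\to A$. The common morphism $e1.t_1=1e.t_2$ is called its multiplication. *)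

(* Defs.v *)
From mathcomp Require Import ssreflect ssrfun.

Set Implicit Arguments.
Unset Strict Implicit.
Unset Printing Implicit Defensive.

Declare Scope cat_scope.
Delimit Scope cat_scope with cat.
Local Open Scope cat_scope.

Reserved Notation "g ∘ f" (at level 40, left associativity).
Reserved Notation "X ⊗ Y" (at level 35, right associativity).
Reserved Notation "f ⊠ g" (at level 35, right associativity).

Record category := Category {
  obj :> Type;
  hom : obj -> obj -> Type;
  idm : forall X, hom X X;
  comp : forall X Y Z, hom Y Z -> hom X Y -> hom X Z;
  comp1m : forall X Y (f : hom X Y), comp (idm Y) f = f;
  compm1 : forall X Y (f : hom X Y), comp f (idm X) = f;
  compA : forall W X Y Z (h : hom Y Z) (g : hom X Y) (f : hom W X),
    comp h (comp g f) = comp (comp h g) f }.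

Arguments hom {c} _ _.
Arguments idm {c} _.
Arguments comp {c X Y Z} _ _.

Notation "g ∘ f" := (comp g f) : cat_scope.

Record monoidal_category := MonoidalCategory {
  mcat :> category;
  munit : mcat;
  tens : mcat -> mcat -> mcat;
  tensm : forall X X' Y Y' : mcat,
    hom X X' -> hom Y Y' -> hom (tens X Y) (tens X' Y');
  tensm1 : forall X Y : mcat, tensm (idm X) (idm Y) = idm (tens X Y);
  tensmM : forall (X X' X'' Y Y' Y'' : mcat)
      (f' : hom X' X'') (f : hom X X') (g' : hom Y' Y'') (g : hom Y Y'),
    tensm (f' ∘ f) (g' ∘ g) = tensm f' g' ∘ tensm f g;

  assoc : forall X Y Z : mcat, hom (tens (tens X Y) Z) (tens X (tens Y Z));
  associ : forall X Y Z : mcat, hom (tens X (tens Y Z)) (tens (tens X Y) Z);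
  assocK : forall X Y Z, associ X Y Z ∘ assoc X Y Z = idm _;
  associK : forall X Y Z, assoc X Y Z ∘ associ X Y Z = idm _;
  assoc_nat : forall (X X' Y Y' Z Z' : mcat)
      (f : hom X X') (g : hom Y Y') (h : hom Z Z'),
    assoc X' Y' Z' ∘ tensm (tensm f g) h = tensm f (tensm g h) ∘ assoc X Y Z;

  lunit : forall X : mcat, hom (tens munit X) X;
  luniti : forall X : mcat, hom X (tens munit X);
  lunitK : forall X, luniti X ∘ lunit X = idm _;
  lunitiK : forall X, lunit X ∘ luniti X = idm _;
  lunit_nat : forall (X X' : mcat) (f : hom X X'),
    lunit X' ∘ tensm (idm munit) f = f ∘ lunit X;

  runit : forall X : mcat, hom (tens X munit) X;
  runiti : forall X : mcat, hom X (tens X munit);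
  runitK : forall X, runiti X ∘ runit X = idm _;
  runitiK : forall X, runit X ∘ runiti X = idm _;
  runit_nat : forall (X X' : mcat) (f : hom X X'),
    runit X' ∘ tensm f (idm munit) = f ∘ runit X;

  pentagon : forall W X Y Z : mcat,
    assoc W X (tens Y Z) ∘ assoc (tens W X) Y Z =
    tensm (idm W) (assoc X Y Z) ∘ assoc W (tens X Y) Z
      ∘ tensm (assoc W X Y) (idm Z);
  triangle : forall X Y : mcat,
    tensm (idm X) (lunit Y) ∘ assoc X munit Y = tensm (runit X) (idm Y) }.

Arguments munit {m}.
Arguments tens {m} _ _.
Arguments tensm {m X X' Y Y'} _ _.
Arguments assoc {m} _ _ _.
Arguments associ {m} _ _ _.
Arguments lunit {m} _.
Arguments luniti {m} _.
Arguments runit {m} _.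
Arguments runiti {m} _.

Notation "X ⊗ Y" := (tens X Y) : cat_scope.
Notation "f ⊠ g" := (tensm f g) : cat_scope.

Record braided_category := BraidedCategory {
  bcat :> monoidal_category;
  braid : forall X Y : bcat, hom (X ⊗ Y) (Y ⊗ X);
  braidi : forall X Y : bcat, hom (Y ⊗ X) (X ⊗ Y);
  braidK : forall X Y, braidi X Y ∘ braid X Y = idm _;
  braidiK : forall X Y, braid X Y ∘ braidi X Y = idm _;
  braid_nat : forall (X X' Y Y' : bcat) (f : hom X X') (g : hom Y Y'),
    braid X' Y' ∘ (f ⊠ g) = (g ⊠ f) ∘ braid X Y;
  hexagon1 : forall X Y Z : bcat,
    assoc Y Z X ∘ braid X (Y ⊗ Z) ∘ assoc X Y Z =
    (idm Y ⊠ braid X Z) ∘ assoc Y X Z ∘ (braid X Y ⊠ idm Z);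
  hexagon2 : forall X Y Z : bcat,
    associ Z X Y ∘ braid (X ⊗ Y) Z ∘ associ X Y Z =
    (braid X Z ⊠ idm Y) ∘ associ X Z Y ∘ (idm X ⊠ braid Y Z) }.

Arguments braid {b} _ _.
Arguments braidi {b} _ _.

Definition is_iso (C : category) (X Y : C) (f : hom X Y) : Prop :=
  exists g : hom Y X, g ∘ f = idm X /\ f ∘ g = idm Y.

Definition is_coequalizer (C : category) (Z X Y : C)
    (p q : hom Z X) (f : hom X Y) : Prop :=
  f ∘ p = f ∘ q /\
  forall (W : C) (g : hom X W), g ∘ p = g ∘ q ->
    exists! h : hom Y W, h ∘ f = g.

Definition is_regular_epi (C : category) (X Y : C) (f : hom X Y) : Prop :=
  exists (Z : C) (p q : hom Z X), is_coequalizer p q f.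

Record epi_class (C : monoidal_category) := EpiClass {
  inQ : forall X Y : C, hom X Y -> Prop;
  Q_regular : forall (X Y : C) (f : hom X Y), inQ f -> is_regular_epi f;
  Q_iso : forall (X Y : C) (f : hom X Y), is_iso f -> inQ f;
  Q_comp : forall (X Y Z : C) (g : hom Y Z) (f : hom X Y),
    inQ g -> inQ f -> inQ (g ∘ f);
  Q_tens : forall (X X' Y Y' : C) (f : hom X X') (g : hom Y Y'),
    inQ f -> inQ g -> inQ (f ⊠ g);
  Q_cancel : forall (X Y Z : C) (t : hom Y Z) (s : hom X Y),
    inQ s -> inQ (t ∘ s) -> inQ t;
  Q_coequalizer : forall (X Y : C) (f : hom X Y), inQ f ->
    exists (Z : C) (p q : hom Z X),
      is_coequalizer p q f /\
      forall W : C,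
        is_coequalizer (idm W ⊠ p) (idm W ⊠ q) (idm W ⊠ f) /\
        is_coequalizer (p ⊠ idm W) (q ⊠ idm W) (f ⊠ idm W) }.

Arguments inQ {C} _ {X Y} _.

(* An object with a multiplication, no axioms; associativity and the other
   conditions are the predicates below. *)
Record magma (C : monoidal_category) := Magma {
  carrier :> C;
  mult : hom (carrier ⊗ carrier) carrier }.

Arguments Magma {C carrier} _.
Arguments mult {C} _.

Section Semigroups.
Variable C : braided_category.

Definition is_semigroup (A : magma C) : Prop :=
  mult A ∘ (mult A ⊠ idm A) = mult A ∘ (idm A ⊠ mult A) ∘ assoc A A A.

Definition nondegenerate (A : magma C) : Prop :=
  forall X Y : C,
    injective (fun f : hom X (Y ⊗ A) =>
      (idm Y ⊠ mult A) ∘ assoc Y A A ∘ (f ⊠ idm A)) /\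
    injective (fun g : hom X (A ⊗ Y) =>
      (mult A ⊠ idm Y) ∘ associ A A Y ∘ (idm A ⊠ g)).

(* (A B) (C D) -> (A C) (B D), the morphism written 1c1. *)
Definition middle4 (W X Y Z : C) :
    hom ((W ⊗ X) ⊗ (Y ⊗ Z)) ((W ⊗ Y) ⊗ (X ⊗ Z)) :=
  associ W Y (X ⊗ Z)
    ∘ (idm W ⊠ (assoc Y X Z ∘ (braid X Y ⊠ idm Z) ∘ associ X Y Z))
    ∘ assoc W X (Y ⊗ Z).

Definition magma_tens (A B : magma C) : magma C :=
  Magma ((mult A ⊠ mult B) ∘ middle4 A B A B).

Definition magma_unit : magma C := Magma (lunit munit).

Record components (A B : C) := Components {
  fst_comp : hom (A ⊗ B) B;
  snd_comp : hom (B ⊗ A) B }.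

Definition is_Mmorphism (A : C) (B : magma C) (f : components A B) : Prop :=
  mult B ∘ (idm B ⊠ fst_comp f) ∘ assoc B A B =
  mult B ∘ (snd_comp f ⊠ idm B).

Definition multiplicative (A B : magma C) (f : components A B) : Prop :=
  fst_comp f ∘ (idm A ⊠ fst_comp f) ∘ assoc A A B =
    fst_comp f ∘ (mult A ⊠ idm B) /\
  snd_comp f ∘ (snd_comp f ⊠ idm A) =
    snd_comp f ∘ (idm B ⊠ mult A) ∘ assoc B A A.

(* [h] is the composite of [f : A -/-> B] followed by [g : B -/-> D]. *)
Definition is_composite (A B : C) (D : magma C)
    (g : components B D) (f : components A B) (h : components A D) : Prop :=
  unique (fun k : components A D =>
    is_Mmorphism k /\
    fst_comp k ∘ (idm A ⊠ fst_comp g) ∘ assoc A B D =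
      fst_comp g ∘ (fst_comp f ⊠ idm D) /\
    snd_comp k ∘ (snd_comp g ⊠ idm A) =
      snd_comp g ∘ (idm D ⊠ snd_comp f) ∘ assoc D B A) h.

Definition M_id (A : magma C) : components A A :=
  Components (mult A) (mult A).

Definition M_tens (A B A' B' : C) (f : components A B) (f' : components A' B') :
    components (A ⊗ A') (B ⊗ B') :=
  Components ((fst_comp f ⊠ fst_comp f') ∘ middle4 A A' B B')
             ((snd_comp f ⊠ snd_comp f') ∘ middle4 B B' A A').

(* Meant for [f] an isomorphism of semigroups. *)
Definition M_of_iso (A : C) (B : magma C) (f : hom A B) : components A B :=
  Components (mult B ∘ (f ⊠ idm B)) (mult B ∘ (idm B ⊠ f)).

End Semigroups.

Arguments magma_unit {C}.

Section CategoryM.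
Variables (C : braided_category) (Q : epi_class C).

Definition M_obj (A : magma C) : Prop :=
  is_semigroup A /\ nondegenerate A /\ inQ Q (mult A).

Definition dense (A B : C) (f : components A B) : Prop :=
  inQ Q (fst_comp f) /\ inQ Q (snd_comp f).

Definition M_hom (A B : magma C) (f : components A B) : Prop :=
  M_obj A /\ M_obj B /\ is_Mmorphism f /\ dense f /\ multiplicative f.

Definition M_assoc (A B D : magma C) :
    components (magma_tens (magma_tens A B) D) (magma_tens A (magma_tens B D)) :=
  M_of_iso (B := magma_tens A (magma_tens B D)) (assoc A B D).

Definition M_lunit (A : magma C) : components (magma_tens magma_unit A) A :=
  M_of_iso (lunit A).

Definition M_runit (A : magma C) : components (magma_tens A magma_unit) A :=
  M_of_iso (runit A).

(* Composition in M is single-valued but only characterised by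
   [is_composite], so each equation between composites in M states that both
   sides are composites equal to one and the same morphism. *)
Definition M_coassociative (A : magma C)
    (d : components A (magma_tens A A)) : Prop :=
  exists (l r : components A _),
    is_composite (D := magma_tens (magma_tens A A) A) (M_tens d (M_id A)) d l /\
    is_composite (D := magma_tens A (magma_tens A A)) (M_tens (M_id A) d) d r /\
    is_composite (D := magma_tens A (magma_tens A A)) (M_assoc A A A) l r.

Definition M_left_counital (A : magma C)
    (d : components A (magma_tens A A)) (e : components A magma_unit) : Prop :=
  exists l : components A _,
    is_composite (D := magma_tens magma_unit A) (M_tens e (M_id A)) d l /\
    is_composite (M_lunit A) l (M_id A).

Definition M_right_counital (A : magma C)
    (d : components A (magma_tens A A)) (e : components A magma_unit) : Prop :=
  exists r : components A _,
    is_composite (D := magma_tens A magma_unit) (M_tens (M_id A) e) d r /\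
    is_composite (M_runit A) r (M_id A).

Definition M_comonoid (A : magma C)
    (d : components A (magma_tens A A)) (e : components A magma_unit) : Prop :=
  M_hom (B := magma_tens A A) d /\
  M_hom (B := magma_unit) e /\
  M_coassociative d /\ M_left_counital d e /\ M_right_counital d e.

End CategoryM.

Section MultiplierBimonoid.
Variable C : braided_category.

(* [f] acting on the first two factors, conjugated by the associativity. *)
Definition on12 (X Y X' Y' Z : C) (f : hom (X ⊗ Y) (X' ⊗ Y')) :
    hom (X ⊗ (Y ⊗ Z)) (X' ⊗ (Y' ⊗ Z)) :=
  assoc X' Y' Z ∘ (f ⊠ idm Z) ∘ associ X Y Z.

Variables (A : C) (t1 t2 : hom (A ⊗ A) (A ⊗ A)) (e : hom A munit).

Local Notation "1" := (idm A).
Local Notation c := (braid A A).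
Local Notation ci := (braidi A A).

Definition fusion_counit1 : Prop :=
  on12 A t1 ∘ (1 ⊠ c) ∘ on12 A t1 ∘ (1 ⊠ ci) ∘ (1 ⊠ t1) =
    (1 ⊠ t1) ∘ on12 A t1 /\
  (1 ⊠ e) ∘ t1 = 1 ⊠ e.

Definition fusion_counit2 : Prop :=
  (1 ⊠ t2) ∘ on12 A c ∘ (1 ⊠ t2) ∘ on12 A ci ∘ on12 A t2 =
    on12 A t2 ∘ (1 ⊠ t2) /\
  (e ⊠ 1) ∘ t2 = e ⊠ 1.

Definition is_multiplier_bimonoid : Prop :=
  fusion_counit1 /\ fusion_counit2 /\
  on12 A t2 ∘ (1 ⊠ t1) = (1 ⊠ t1) ∘ on12 A t2 /\
  lunit A ∘ (e ⊠ 1) ∘ t1 = runit A ∘ (1 ⊠ e) ∘ t2.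

Definition bimonoid_mult : hom (A ⊗ A) A := lunit A ∘ (e ⊠ 1) ∘ t1.

Variable m : hom (A ⊗ A) A.

Definition d1 : hom (A ⊗ (A ⊗ A)) (A ⊗ A) :=
  (m ⊠ 1) ∘ associ A A A ∘ (1 ⊠ c) ∘ on12 A t1 ∘ (1 ⊠ ci).

Definition d2 : hom ((A ⊗ A) ⊗ A) (A ⊗ A) :=
  (1 ⊠ m) ∘ on12 A c ∘ (1 ⊠ t2) ∘ on12 A ci ∘ assoc A A A.

End MultiplierBimonoid.

Definition comult_pair (C : braided_category) (A : magma C)
    (t1 t2 : hom (A ⊗ A) (A ⊗ A)) : components A (magma_tens A A) :=
  @Components C A (magma_tens A A) (d1 t1 (mult A)) (d2 t2 (mult A)).

(* The pair (e, e), with the identifications A I = A = I A made explicit. *)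
Definition counit_pair (C : braided_category) (A : magma C) (e : hom A munit) :
    components A magma_unit :=
  @Components C A magma_unit (e ∘ runit A) (e ∘ lunit A).

(* Main.v *)
From mathcomp Require Import all_boot.
Require Import Defs.

Set Implicit Arguments.
Unset Strict Implicit.
Unset Printing Implicit Defensive.
Local Open Scope cat_scope.

(** Read t1 as the map a ⊗ b |-> Δ(a)(1 ⊗ b) and t2 as a ⊗ b |-> (a ⊗ 1)Δ(b),
    for a comultiplication Δ that need not exist as a morphism.  Then d1 is
    a ⊗ b ⊗ c |-> Δ(a)(b ⊗ c) and d2 is a ⊗ b ⊗ c |-> (a ⊗ b)Δ(c).  A comonoid
    in the category of the theorem is a set of equations between the d's, a
    multiplier bimonoid is a set of equations between the t's, and one passes
    from the t's to the d's by multiplying with further factors.  These can be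
    cancelled again: the multiplication is nondegenerate, and it, e, d1 and d2
    are epimorphisms, also after tensoring with identities.  In this way

    - (d1, d2) is an M-morphism iff m1.1t1 = 1m.t21 (the exchange law);
    - d1 is multiplicative iff t1.m1 = d1.1t1, that is Δ(ab) = Δ(a)Δ(b);
    - the counit laws for first components are e1.t1 = m and 1e.t1 = 1e;
    - both iterated comultiplications have as first component one explicit
      map delta3, a ⊗ p ⊗ q ⊗ r |-> Δ²(a)(p ⊗ q ⊗ r) built from t1; that it is
      the composite through Δ ⊗ 1 follows from the laws above, and that it is
      the composite through 1 ⊗ Δ is, after cancelling, the fusion equation;
    - the equation t21.1t1 = 1t1.t21, stronger than the exchange law, follows
      from the exchange law and the fusion equation: multiply by x on the
      left, use the fusion equation, and cancel d1.  Conversely it is what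
      makes the explicit iterated comultiplication an M-morphism.

    First components involve t1 only and second components t2 only, and the
    second components are the first components of the same data in the
    reversed category (mirror).  So the equivalence is proved for first
    components, in any braided category, in multiplier_half_of_comonoid and
    half_of_multiplier, and used twice.

    The calculations are carried out as if the category were strict.  A word
    lists letters (m, c, its inverse, t1, t2, e), each with the number of
    strands to its left, in order of application.  Every morphism written with
    associators and unitors has a word, and two such morphisms are equal iff
    their words have equal values (mval_weq); so equations between words are
    both the hypotheses and the goals.  The tactic link looks for a chain of
    rewritings between two words; what enters the proof is the chain, whose
    steps are checked by derivation_sound.

    One device shortens all calculations.  Let n = m.c^-1 be the opposite
    multiplication.  Since t1 slides along the braiding, d1.(c^-1 1) equals
    (n1).(1t1): a factor that multiplies from the right can be moved to the far
    left, where it acts through n, and n is nondegenerate on the left because m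
    is nondegenerate on the right (opposite_nondegenerate). *)

(** * Coherence in a monoidal category *)

Section Basics.
Variable C : braided_category.

Lemma tens_compl (X X' X'' Y : C) (g : hom X' X'') (f : hom X X') :
  (g ∘ f) ⊠ idm Y = (g ⊠ idm Y) ∘ (f ⊠ idm Y).
Proof. by rewrite -tensmM comp1m. Qed.

Lemma tens_compr (X Y Y' Y'' : C) (g : hom Y' Y'') (f : hom Y Y') :
  idm X ⊠ (g ∘ f) = (idm X ⊠ g) ∘ (idm X ⊠ f).
Proof. by rewrite -tensmM comp1m. Qed.

Lemma tens_split (X X' Y Y' : C) (f : hom X X') (g : hom Y Y') :
  f ⊠ g = (f ⊠ idm Y') ∘ (idm X ⊠ g).
Proof. by rewrite -tensmM comp1m compm1. Qed.

Lemma tens_swap (X X' Y Y' : C) (f : hom X X') (g : hom Y Y') :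
  (f ⊠ idm Y') ∘ (idm X ⊠ g) = (idm X' ⊠ g) ∘ (f ⊠ idm Y).
Proof. by rewrite -!tensmM !comp1m !compm1. Qed.

Lemma split_epi_cancel (X Y Z : C) (f : hom X Y) (s : hom Y X) (g h : hom Y Z) :
  f ∘ s = idm Y -> g ∘ f = h ∘ f -> g = h.
Proof. by move=> fs E; rewrite -[g]compm1 -[h]compm1 -fs !compA E. Qed.

Lemma split_mono_cancel (X Y Z : C) (f : hom Y Z) (r : hom Z Y) (g h : hom X Y) :
  r ∘ f = idm Y -> f ∘ g = f ∘ h -> g = h.
Proof. by move=> rf E; rewrite -[g]comp1m -[h]comp1m -rf -!compA E. Qed.

Lemma associ_nat (X X' Y Y' Z Z' : C)
    (f : hom X X') (g : hom Y Y') (h : hom Z Z') :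
  associ X' Y' Z' ∘ (f ⊠ (g ⊠ h)) = ((f ⊠ g) ⊠ h) ∘ associ X Y Z.
Proof.
apply: (split_mono_cancel (assocK X' Y' Z')).
by rewrite !compA associK comp1m assoc_nat -compA associK compm1.
Qed.

Lemma tens_munit_faithful (X Y : C) (f g : hom X Y) :
  f ⊠ idm munit = g ⊠ idm munit -> f = g.
Proof.
by move=> E; apply: (split_epi_cancel (runitiK X)); rewrite -!runit_nat E.
Qed.

Lemma munit_tens_faithful (X Y : C) (f g : hom X Y) :
  idm munit ⊠ f = idm munit ⊠ g -> f = g.
Proof.
by move=> E; apply: (split_epi_cancel (lunitiK X)); rewrite -!lunit_nat E.
Qed.

(** The classical consequence of pentagon and triangle: both sides become equal
    after tensoring with the unit on the left, which is faithful. *)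
Lemma lunit_tens (X Y : C) : lunit (X ⊗ Y) ∘ assoc munit X Y = lunit X ⊠ idm Y.
Proof.
apply: munit_tens_faithful.
apply: (@split_epi_cancel _ _ _ (assoc munit (munit ⊗ X) Y) (associ _ _ _)).
  exact: associK.
apply: (@split_epi_cancel _ _ _ (assoc munit munit X ⊠ idm Y)
          (associ munit munit X ⊠ idm Y)).
  by rewrite -tensmM associK comp1m tensm1.
rewrite tens_compr -!compA.
have := pentagon munit munit X Y; rewrite -!compA => <-.
rewrite compA triangle -(tensm1 X Y) -assoc_nat -triangle tens_compl compA.
by rewrite assoc_nat -compA.
Qed.

Lemma lunit_runit_munit : lunit (munit : C) = runit munit.
Proof.
apply: tens_munit_faithful; rewrite -lunit_tens -triangle; congr (_ ∘ _).
apply: (split_mono_cancel (lunitK _)).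
by rewrite lunit_nat.
Qed.

End Basics.

(** * The reversed category *)
Section Reverse.
Variable C : braided_category.

Lemma mirror_pentagon (W X Y Z : C) :
  associ (Z ⊗ Y) X W ∘ associ Z Y (X ⊗ W) =
  (associ Z Y X ⊠ idm W) ∘ associ Z (Y ⊗ X) W ∘ (idm Z ⊠ associ Y X W).
Proof.
apply: (@split_mono_cancel _ _ _ _ (assoc Z Y (X ⊗ W) ∘ assoc (Z ⊗ Y) X W)
          (associ (Z ⊗ Y) X W ∘ associ Z Y (X ⊗ W))).
  by rewrite -compA [_ ∘ (assoc Z _ _ ∘ _)]compA assocK comp1m assocK.
rewrite [LHS]compA -[in LHS](compA (assoc Z Y _)) associK compm1 associK pentagon.
rewrite -!compA [(assoc Z Y X ⊠ _) ∘ _]compA -tensmM associK comp1m tensm1 comp1m.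
by rewrite [assoc Z _ _ ∘ _]compA associK comp1m -tensmM associK comp1m tensm1.
Qed.

Lemma mirror_triangle (X Y : C) :
  (runit Y ⊠ idm X) ∘ associ Y munit X = idm Y ⊠ lunit X.
Proof. by rewrite -triangle -compA associK compm1. Qed.

Definition mirror_monoidal : monoidal_category :=
  @MonoidalCategory C munit (fun X Y => Y ⊗ X) (fun _ _ _ _ f g => g ⊠ f)
    (fun X Y => tensm1 Y X) (fun _ _ _ _ _ _ f' f g' g => tensmM g' g f' f)
    (fun X Y Z => associ Z Y X) (fun X Y Z => assoc Z Y X)
    (fun X Y Z => associK Z Y X) (fun X Y Z => assocK Z Y X)
    (fun _ _ _ _ _ _ f g h => associ_nat h g f)
    (fun X => runit X) (fun X => runiti X)
    (fun X => runitK X) (fun X => runitiK X) (fun _ _ f => runit_nat f)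
    (fun X => lunit X) (fun X => luniti X)
    (fun X => lunitK X) (fun X => lunitiK X) (fun _ _ f => lunit_nat f)
    mirror_pentagon mirror_triangle.

(** The braiding X ⊗' Y -> Y ⊗' X is the given one on Y ⊗ X, not an inverse:
    with this choice reversal exchanges the formulas for d1 and d2, and the two
    hexagons. *)
Definition mirror : braided_category :=
  @BraidedCategory mirror_monoidal (fun X Y => braid Y X) (fun X Y => braidi Y X)
    (fun X Y => braidK Y X) (fun X Y => braidiK Y X)
    (fun _ _ _ _ f g => braid_nat g f)
    (fun X Y Z => hexagon2 Z Y X) (fun X Y Z => hexagon1 Z Y X).

End Reverse.

(** * Strictification *)

(** Bracketed powers of one object, with units. *)
Inductive shape := One | At | Pair of shape & shape.

(** An accumulator in place of size o + n, so that the power of A at height o n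
    unfolds by computation along o and no transport between equal natural
    numbers is ever needed. *)
Fixpoint height (o : shape) (n : nat) : nat :=
  match o with
  | One => n
  | At => n.+1
  | Pair o o' => height o (height o' n)
  end.

Fixpoint size (o : shape) : nat :=
  match o with One => 0 | At => 1 | Pair o o' => size o + size o' end.

Lemma heightE o n : height o n = size o + n.
Proof. by elim: o n => //= o IH o' IH' n; rewrite IH IH' addnA. Qed.

Inductive letter := LM | LC | LCi | L1 | L2 | LE.

Definition dom (g : letter) : shape := if g is LE then At else Pair At At.
Definition cod (g : letter) : shape :=
  match g with LM => At | LE => One | _ => Pair At At end.
Notation ar g := (size (dom g)).
Notation coar g := (size (cod g)).

Definition word := seq (nat * letter).
Definition shift (k : nat) (w : word) : word := [seq (k + x.1, x.2) | x <- w].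

(** A strand passes q strands, and in crossing p strands do so one after the
    other, the rightmost first. *)
Definition xrow (q : nat) : word := [seq (j, LC) | j <- iota 0 q].
Fixpoint crossing (p q : nat) : word :=
  if p is p'.+1 then shift 1 (crossing p' q) ++ xrow q else [::].

Lemma shiftD k l w : shift k (shift l w) = shift (k + l) w.
Proof. by rewrite /shift -map_comp; apply: eq_map => x /=; rewrite addnA. Qed.

Lemma shift_cat k w w' : shift k (w ++ w') = shift k w ++ shift k w'.
Proof. exact: map_cat. Qed.

Lemma shift0 w : shift 0 w = w.
Proof. by rewrite /shift -[RHS]map_id; apply: eq_map => -[]. Qed.

Lemma xrowD p q : xrow (p + q) = xrow p ++ shift p (xrow q).
Proof.
rewrite /xrow iotaD map_cat; congr (_ ++ _).
by rewrite add0n /shift -map_comp -[p in iota p _]addn0 iotaDl -map_comp.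
Qed.

Lemma crossingDl p p' q :
  crossing (p + p') q = shift p (crossing p' q) ++ crossing p q.
Proof.
elim: p => [|p IH] /=; first by rewrite cats0 shift0.
by rewrite IH shift_cat shiftD catA add1n.
Qed.

Record bialgebra_data (C : braided_category) := Data {
  base : magma C;
  op1 : hom (base ⊗ base) (base ⊗ base);
  op2 : hom (base ⊗ base) (base ⊗ base);
  ope : hom base munit }.

Section Strictification.
Variables (C : braided_category) (D : bialgebra_data C).
Local Notation A := (base D).

Fixpoint obj_of (o : shape) : C :=
  match o with One => munit | At => A | Pair o o' => obj_of o ⊗ obj_of o' end.

Definition raw (g : letter) : hom (obj_of (dom g)) (obj_of (cod g)) :=
  match g with
  | LM => mult A | LC => braid A A | LCi => braidi A A
  | L1 => op1 D | L2 => op2 D | LE => ope D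
  end.

Section Tail.
Variable Z : C.

Fixpoint pow (n : nat) : C := if n is n'.+1 then A ⊗ pow n' else Z.

(** The canonical isomorphism that removes all brackets and units in front of a
    right-nested power; the objects pow n are the powers of A followed by an
    arbitrary tail Z. *)
Fixpoint flat o n : hom (obj_of o ⊗ pow n) (pow (height o n)) :=
  match o with
  | One => lunit _
  | At => idm _
  | Pair o o' => flat o (height o' n) ∘ (idm _ ⊠ flat o' n) ∘ assoc _ _ _
  end.

Fixpoint flati o n : hom (pow (height o n)) (obj_of o ⊗ pow n) :=
  match o with
  | One => luniti _
  | At => idm _
  | Pair o o' => associ _ _ _ ∘ (idm _ ⊠ flati o' n) ∘ flati o (height o' n)
  end.

Lemma flatK o n : flati o n ∘ flat o n = idm _.
Proof.
elim: o n => [n|n|o IH o' IH' n] /=; [exact: lunitK|exact: comp1m|].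
rewrite -!compA [flati o _ ∘ _]compA IH comp1m [(_ ⊠ _) ∘ _]compA.
by rewrite -tens_compr IH' tensm1 comp1m assocK.
Qed.

Lemma flatiK o n : flat o n ∘ flati o n = idm _.
Proof.
elim: o n => [n|n|o IH o' IH' n] /=; [exact: lunitiK|exact: comp1m|].
rewrite -!compA [assoc _ _ _ ∘ _]compA associK comp1m.
by rewrite [(_ ⊠ _) ∘ _]compA -tens_compr IH' tensm1 comp1m IH.
Qed.

Fixpoint under o n p : hom (pow n) (pow p) -> hom (pow (height o n)) (pow (height o p)) :=
  match o with
  | One => fun f => f
  | At => fun f => idm A ⊠ f
  | Pair o o' => fun f => under o (under o' f)
  end.

Lemma flat_nat o n p (f : hom (pow n) (pow p)) :
  flat o p ∘ (idm _ ⊠ f) = under o f ∘ flat o n.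
Proof.
elim: o n p f => [|n p f|o IH o' IH' n p f] /=; first by move=> n p f; apply: lunit_nat.
  by rewrite comp1m compm1.
rewrite -(tensm1 (obj_of o)) -!compA assoc_nat [(idm _ ⊠ flat _ _) ∘ _]compA.
by rewrite -tens_compr IH' tens_compr !compA IH.
Qed.

Lemma flati_nat o n p (f : hom (pow n) (pow p)) :
  flati o p ∘ under o f = (idm _ ⊠ f) ∘ flati o n.
Proof.
apply: (split_mono_cancel (flatK o p)).
by rewrite !compA flatiK comp1m flat_nat -compA flatiK compm1.
Qed.

(** This makes the action X |-> X ⊗ - strict: associators and unitors act as
    identities, composites as composites, and f ⊠ g as f in front of g. *)
Definition strict o o' (f : hom (obj_of o) (obj_of o')) n :
    hom (pow (height o n)) (pow (height o' n)) :=
  flat o' n ∘ (f ⊠ idm _) ∘ flati o n.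

Lemma strict_id o n : strict (idm (obj_of o)) n = idm _.
Proof. by rewrite /strict tensm1 compm1 flatiK. Qed.

Lemma strict_comp o o' o'' (g : hom (obj_of o') (obj_of o''))
    (f : hom (obj_of o) (obj_of o')) n :
  strict (g ∘ f) n = strict g n ∘ strict f n.
Proof.
by rewrite /strict -!compA [flati _ _ ∘ _]compA flatK comp1m tens_compl !compA.
Qed.

Lemma strict_nat o o' (f : hom (obj_of o) (obj_of o')) n p (h : hom (pow n) (pow p)) :
  strict f p ∘ under o h = under o' h ∘ strict f n.
Proof.
rewrite /strict -compA flati_nat !compA -flat_nat -!compA; congr (_ ∘ _).
by rewrite !compA tens_swap.
Qed.

Lemma strict_tens o o' p p' (f : hom (obj_of o) (obj_of o'))
    (g : hom (obj_of p) (obj_of p')) n :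
  @strict (Pair o p) (Pair o' p') (f ⊠ g) n = strict f (height p' n) ∘ under o (strict g n).
Proof.
rewrite {2}/strict -[RHS]compA flati_nat /strict /= -!compA; congr (_ ∘ _).
rewrite !tens_compr !compA; congr (_ ∘ _ ∘ _).
rewrite -[LHS]compA -[_ ∘ assoc _ _ _ ∘ _]compA.
rewrite [assoc _ _ _ ∘ (_ ∘ _)]compA assoc_nat -!compA associK compm1.
by rewrite !compA tens_swap -compA -tens_split.
Qed.

(** This is the pentagon. *)
Lemma strict_assoc o o' o'' n :
  @strict (Pair (Pair o o') o'') (Pair o (Pair o' o'')) (assoc _ _ _) n = idm _.
Proof.
rewrite -[RHS](flatiK (Pair (Pair o o') o'')) /strict; congr (_ ∘ _) => /=.
rewrite !tens_compr -!compA.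
have := pentagon (obj_of o) (obj_of o') (obj_of o'') (pow n).
rewrite -!compA => <-; congr (_ ∘ (_ ∘ _)).
by rewrite !compA -(tensm1 (obj_of o)) -assoc_nat tensm1.
Qed.

Lemma strict_associ o o' o'' n :
  @strict (Pair o (Pair o' o'')) (Pair (Pair o o') o'') (associ _ _ _) n = idm _.
Proof.
have := @strict_comp (Pair (Pair o o') o'') (Pair o (Pair o' o''))
  (Pair (Pair o o') o'') (associ _ _ _) (assoc _ _ _) n.
rewrite strict_assoc compm1 assocK => <-.
exact: (strict_id (Pair (Pair o o') o'')).
Qed.

Lemma strict_lunit o n : @strict (Pair One o) o (lunit _) n = idm _.
Proof.
rewrite -[RHS](flatiK (Pair One o)) /strict /=; congr (_ ∘ _).
by rewrite lunit_nat -compA lunit_tens.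
Qed.

Lemma strict_luniti o n : @strict o (Pair One o) (luniti _) n = idm _.
Proof.
have := @strict_comp o (Pair One o) o (lunit _) (luniti _) n.
by rewrite strict_lunit comp1m lunitiK strict_id.
Qed.

Lemma strict_runit o n : @strict (Pair o One) o (runit _) n = idm _.
Proof.
rewrite -[RHS](flatiK (Pair o One)) /strict /=; congr (_ ∘ _).
by rewrite -compA triangle.
Qed.

Lemma strict_runiti o n : @strict o (Pair o One) (runiti _) n = idm _.
Proof.
have := @strict_comp o (Pair o One) o (runit _) (runiti _) n.
by rewrite strict_runit comp1m runitiK strict_id.
Qed.

Definition strict_braid o o' n := @strict (Pair o o') (Pair o' o) (braid _ _) n.

Lemma under_id o n : under o (idm (pow n)) = idm _.
Proof. by elim: o n => //= [n|o IH o' IH' n]; rewrite ?tensm1 ?IH' ?IH. Qed.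

Lemma under_comp o n p q (g : hom (pow p) (pow q)) (f : hom (pow n) (pow p)) :
  under o (g ∘ f) = under o g ∘ under o f.
Proof.
by elim: o n p q g f => //= [n p q g f|o IH o' IH' n p q g f];
  rewrite ?tens_compr ?IH' ?IH.
Qed.

Lemma strict_braid_pairr o p q n :
  strict_braid o (Pair p q) n = under p (strict_braid o q n) ∘ strict_braid o p (height q n).
Proof.
have := congr1 (fun f => @strict (Pair (Pair o p) q) (Pair p (Pair q o)) f n)
  (hexagon1 (obj_of o) (obj_of p) (obj_of q)).
rewrite !(@strict_comp (Pair (Pair o p) q) (Pair o (Pair p q)) (Pair p (Pair q o))).
rewrite (@strict_comp (Pair o (Pair p q)) (Pair (Pair p q) o) (Pair p (Pair q o))).
rewrite !strict_assoc compm1 comp1m => E; rewrite /strict_braid; etransitivity; first exact: E.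
rewrite (@strict_comp _ (Pair (Pair p o) q)) (@strict_comp _ (Pair p (Pair o q))).
rewrite strict_assoc compm1.
rewrite (@strict_tens p p (Pair o q) (Pair q o)) (@strict_tens (Pair o p) (Pair p o)) /=.
by rewrite !strict_id comp1m !under_id compm1.
Qed.

Lemma strict_braid_pairl o p q n :
  strict_braid (Pair o p) q n = strict_braid o q (height p n) ∘ under o (strict_braid p q n).
Proof.
have := congr1 (fun f => @strict (Pair o (Pair p q)) (Pair (Pair q o) p) f n)
  (hexagon2 (obj_of o) (obj_of p) (obj_of q)).
rewrite !(@strict_comp (Pair o (Pair p q)) (Pair (Pair o p) q) (Pair (Pair q o) p)).
rewrite (@strict_comp (Pair (Pair o p) q) (Pair q (Pair o p)) (Pair (Pair q o) p)).
rewrite !strict_associ compm1 comp1m => E; rewrite /strict_braid; etransitivity; first exact: E.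
rewrite (@strict_comp _ (Pair o (Pair q p))) (@strict_comp _ (Pair (Pair o q) p)).
rewrite strict_associ compm1.
rewrite (@strict_tens o o (Pair p q) (Pair q p)) (@strict_tens (Pair o q) (Pair q o)) /=.
by rewrite !strict_id comp1m !under_id compm1.
Qed.

(** By the hexagon for I ⊗ I and naturality along the isomorphism of I ⊗ I with
    I, the strict form of the braiding with the unit is an idempotent
    isomorphism. *)
Lemma strict_braid_onel o n : strict_braid One o n = idm _.
Proof.
have [g gK] : exists g, g ∘ strict_braid One o n = idm _.
  exists (@strict (Pair o One) (Pair One o) (braidi _ _) n).
  by rewrite -strict_comp braidK (strict_id (Pair One o)).
apply: (split_mono_cancel gK); rewrite compm1.
have E := strict_braid_pairl One One o n; rewrite /= in E; rewrite -E.
have := congr1 (fun f => @strict (Pair (Pair One One) o) (Pair o One) f n)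
  (braid_nat (lunit munit) (idm (obj_of o))).
rewrite (@strict_comp _ (Pair One o)) (@strict_comp _ (Pair o (Pair One One))).
rewrite (@strict_tens (Pair One One) One o o) (@strict_tens o o (Pair One One) One).
by rewrite !strict_id /= !(@strict_lunit One) !under_id !compm1 comp1m.
Qed.

Lemma strict_braid_oner o n : strict_braid o One n = idm _.
Proof.
have [g gK] : exists g, g ∘ strict_braid o One n = idm _.
  exists (@strict (Pair One o) (Pair o One) (braidi _ _) n).
  by rewrite -strict_comp braidK (strict_id (Pair o One)).
apply: (split_mono_cancel gK); rewrite compm1.
have E := strict_braid_pairr o One One n; rewrite /= in E; rewrite -E.
have := congr1 (fun f => @strict (Pair o (Pair One One)) (Pair One o) f n)
  (braid_nat (idm (obj_of o)) (lunit munit)).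
rewrite (@strict_comp _ (Pair o One)) (@strict_comp _ (Pair (Pair One One) o)).
rewrite (@strict_tens (Pair One One) One o o) (@strict_tens o o (Pair One One) One).
by rewrite !strict_id /= !(@strict_lunit One) !under_id !compm1 comp1m.
Qed.

End Tail.

(** With tail I and no further strands, the strict form is a conjugate of
    f ⊠ 1, and tensoring with I is faithful. *)
Lemma strict_faithful o o' (f g : hom (obj_of o) (obj_of o')) :
  strict munit f 0 = strict munit g 0 -> f = g.
Proof.
move=> /(split_epi_cancel (flatK munit o 0)).
by move/(split_mono_cancel (flatK munit o' 0))/tens_munit_faithful.
Qed.

End Strictification.

(** * Words and their values *)
Section Running.
Variables (C : braided_category) (D : bialgebra_data C).
Local Notation A := (base D).
Section Tail.
Variable Z : C.
Local Notation pow := (pow D Z).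

(** A word can be applied to n strands only if it never runs out of strands;
    the number of output strands is part of the value. *)
Definition arrow n := option {p : nat & hom (pow n) (pow p)}.
Definition arr n p (f : hom (pow n) (pow p)) : arrow n :=
  Some (existT (fun p => hom (pow n) (pow p)) p f).

Definition bind n (x : arrow n) (k : forall p, arrow p) : arrow n :=
  if x is Some (existT p f) then
    if k p is Some (existT q g) then arr (g ∘ f) else None
  else None.

Definition underA o n (x : arrow n) : arrow (height o n) :=
  if x is Some (existT p f) then arr (under o f) else None.

Definition act0 (g : letter) : forall n, arrow n :=
  let some g j := @arr (height (dom g) j) _ (strict Z (raw D g) j) in
  match g with
  | LM => fun n => if n is j.+2 then some LM j else None
  | LC => fun n => if n is j.+2 then some LC j else None
  | LCi => fun n => if n is j.+2 then some LCi j else None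
  | L1 => fun n => if n is j.+2 then some L1 j else None
  | L2 => fun n => if n is j.+2 then some L2 j else None
  | LE => fun n => if n is j.+1 then some LE j else None
  end.

(** The letter is reached by peeling off the k leading strands one at a time,
    so that source and target are right-nested powers by computation. *)
Fixpoint act (k : nat) (g : letter) (n : nat) : arrow n :=
  match k with
  | 0 => act0 g n
  | k'.+1 => if n is n'.+1 then underA At (act k' g n') else None
  end.

Fixpoint run (w : word) (n : nat) : arrow n :=
  if w is x :: w' then bind (act x.1 x.2 n) (run w') else arr (idm _).

Lemma bind_arr n p (f : hom (pow n) (pow p)) q (g : hom (pow p) (pow q)) k :
  k p = arr g -> bind (arr f) k = arr (g ∘ f).
Proof. by rewrite /bind /= => ->. Qed.

Lemma bindA n (x : arrow n) k k' :
  bind (bind x k) k' = bind x (fun p => bind (k p) k').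
Proof.
case: x => [[p f]|] //=; case: (k p) => [[q g]|] //=.
by case: (k' q) => [[r h]|] //=; rewrite compA.
Qed.

Lemma eq_bind n (x : arrow n) k k' : (forall p, k p = k' p) -> bind x k = bind x k'.
Proof. by move=> E; case: x => [[p f]|] //=; rewrite E. Qed.

Lemma bind_id n (x : arrow n) : bind x (fun p => arr (idm _)) = x.
Proof. by case: x => [[p f]|] //=; rewrite comp1m. Qed.

Lemma bind_idl n k : bind (@arr n n (idm _)) k = k n.
Proof. by rewrite /bind /=; case: (k n) => [[p f]|] //=; rewrite compm1. Qed.

Local Arguments bind : simpl never.

Lemma run_cat w w' n : run (w ++ w') n = bind (run w n) (run w').
Proof.
elim: w n => [|x w IH] n /=; first by rewrite bind_idl.
by rewrite bindA; apply: eq_bind.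
Qed.

Lemma underA_bind o n (x : arrow n) (k k' : forall p, arrow p) :
  (forall p, k' (height o p) = underA o (k p)) ->
  underA o (bind x k) = bind (underA o x) k'.
Proof.
move=> E; case: x => [[p f]|] //; rewrite /bind /= E.
by case: (k p) => [[q g]|] //=; rewrite under_comp.
Qed.

Lemma act_under o k g n : act (size o + k) g (height o n) = underA o (act k g n).
Proof.
elim: o k n => [|//|o IH o' IH'] k n /=; first by case: act => [[]|].
by rewrite -addnA IH IH'; case: act => [[]|].
Qed.

Lemma run_under o w n : run (shift (size o) w) (height o n) = underA o (run w n).
Proof.
elim: w n => [|[k g] w IH] n /=; first by rewrite under_id.
by rewrite act_under; apply/esym/underA_bind => p; rewrite IH.
Qed.

Lemma act0_dom g n : act0 g (height (dom g) n) = arr (strict Z (raw D g) n).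
Proof. by case: g. Qed.

Lemma act_dom g n :
  (exists j, n = height (dom g) j) \/
  (act0 g n = None /\ forall k g', act (ar g + k) g' n = None).
Proof.
case: g; case: n => [|[|j]] /=; try by [right];
  (by left; exists j) || by (left; exists j.+1) || by (left; exists 0).
Qed.

(** The interchange law: letters on disjoint strands commute.  It holds because
    the strict form of a morphism is natural in the tail. *)
Lemma run_swap0 g g' i n :
  run [:: (0, g); (coar g + i, g')] n = run [:: (ar g + i, g'); (0, g)] n.
Proof.
case: (act_dom g n) => [[j ->]|[E E']]; last by rewrite /run /= E E'.
rewrite /= act0_dom act_under.
rewrite /bind /= act_under; case: act => [[p f]|] //=.
by rewrite act0_dom /= !comp1m strict_nat.
Qed.

Lemma run_cons2 x y w n : run (x :: y :: w) n = bind (run [:: x; y] n) (run w).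
Proof. exact: (run_cat [:: x; y]). Qed.

Lemma run_swap k g g' i w n :
  run ((k, g) :: (k + (coar g + i), g') :: w) n =
  run ((k + (ar g + i), g') :: (k, g) :: w) n.
Proof.
rewrite run_cons2 [RHS]run_cons2; congr (bind _ _).
elim: k n => [|k IH] n; first exact: run_swap0.
case: n => [|n] //; have E := run_under At.
transitivity (underA At (run [:: (k, g); (k + (coar g + i), g')] n)).
  by rewrite -E.
by rewrite IH -E.
Qed.

End Tail.
End Running.

Arguments bind : simpl never.

(** * Morphisms quoted as words *)

(** Formal morphisms with associators, unitors, and braidings of composite
    objects; they are quoted from morphisms by the tactic quote below. *)
Inductive mor : shape -> shape -> Type :=
| Id o : mor o o
| Seq o o' o'' : mor o' o'' -> mor o o' -> mor o o''
| Par o o' p p' : mor o o' -> mor p p' -> mor (Pair o p) (Pair o' p')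
| Ass o p q : mor (Pair (Pair o p) q) (Pair o (Pair p q))
| Assi o p q : mor (Pair o (Pair p q)) (Pair (Pair o p) q)
| Lun o : mor (Pair One o) o
| Luni o : mor o (Pair One o)
| Run o : mor (Pair o One) o
| Runi o : mor o (Pair o One)
| Brd o p : mor (Pair o p) (Pair p o)
| Ltr g : mor (dom g) (cod g).

Fixpoint mword o o' (u : mor o o') : word :=
  match u with
  | Seq _ _ _ v u => mword u ++ mword v
  | @Par o _ _ _ u v => shift (size o) (mword v) ++ mword u
  | Brd o p => crossing (size o) (size p)
  | Ltr g => [:: (0, g)]
  | _ => [::]
  end.

Definition letter_width (x : nat * letter) (n : nat) : option nat :=
  if x.1 + ar x.2 <= n then Some (n - ar x.2 + coar x.2) else None.
Definition width (w : word) (n : nat) : option nat :=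
  foldl (fun n x => obind (letter_width x) n) (Some n) w.
Definition fits (w : word) (n k : nat) : bool :=
  if width w n is Some p then k <= p else false.

(** The normal form for interchange applies letters on the left as early as
    possible. *)
Fixpoint insert (x : nat * letter) (w : word) : word :=
  if w is y :: w' then
    if y.1 + ar y.2 <= x.1 then
      y :: insert (x.1 - ar y.2 + coar y.2, x.2) w'
    else x :: w
  else [:: x].
Definition nf (w : word) : word := foldr insert [::] w.

Lemma width_cons x w n : width (x :: w) n = obind (width w) (letter_width x n).
Proof.
rewrite {1}/width /=; case: (letter_width x n) => [p|] //=.
by elim: w {x} => //=.
Qed.

Lemma width_cat u v n p : width u n = Some p -> width (u ++ v) n = width v p.
Proof. by rewrite /width foldl_cat => ->. Qed.

Lemma width_shift k w n p :
  width w n = Some p -> width (shift k w) (k + n) = Some (k + p).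
Proof.
elim: w n => [|x w IH] n; first by case=> ->.
rewrite /= !width_cons /letter_width /= -addnA leq_add2l.
case: leqP => //= le /IH <-; congr (width _ _).
by rewrite -!addnBA ?(leq_trans (leq_addl _ _) le) // addnA.
Qed.

Section Words.
Variables (C : braided_category) (D : bialgebra_data C).
Local Notation A := (base D).

Fixpoint mval o o' (u : mor o o') : hom (obj_of D o) (obj_of D o') :=
  match u with
  | Id _ => idm _
  | Seq _ _ _ v u => mval v ∘ mval u
  | Par _ _ _ _ u v => mval u ⊠ mval v
  | Ass _ _ _ => assoc _ _ _
  | Assi _ _ _ => associ _ _ _
  | Lun _ => lunit _
  | Luni _ => luniti _
  | Run _ => runit _
  | Runi _ => runiti _
  | Brd _ _ => braid _ _
  | Ltr g => raw D g
  end.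

Lemma run_crossing Z o p n :
  run D Z (crossing (size o) (size p)) (height o (height p n)) =
  arr (@strict_braid C D Z o p n).
Proof.
elim: o n => [|| o IH o' IH'] n /=.
- by rewrite strict_braid_onel.
- elim: p n => [|| p IHp q IHq] n /=.
  + by rewrite strict_braid_oner.
  + by rewrite bind_id.
  + rewrite xrowD run_cat IHp (@bind_arr _ _ _ _ _ _ _ (under p (strict_braid D Z At q n))) //.
      by rewrite strict_braid_pairr.
    by rewrite (run_under D Z p) IHq.
- rewrite crossingDl run_cat (run_under D Z o) IH' /=.
  by rewrite (bind_arr _ (IH _)) strict_braid_pairl.
Qed.

Lemma run_mword Z o o' (u : mor o o') n :
  run D Z (mword u) (height o n) = arr (strict Z (mval u) n).
Proof.
elim: u n => {o o'} [o|o o' o'' v IHv u IHu|o o' p p' u IHu v IHv|o p q|o p q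
  |o|o|o|o|o p|g] n /=.
- by rewrite strict_id.
- by rewrite run_cat IHu (bind_arr _ (IHv _)) strict_comp.
- rewrite run_cat run_under IHv /= (bind_arr _ (IHu _)).
  by rewrite -strict_tens.
- by rewrite strict_assoc.
- by rewrite strict_associ.
- by rewrite strict_lunit.
- by rewrite strict_luniti.
- by rewrite strict_runit.
- by rewrite strict_runiti.
- exact: run_crossing.
- by rewrite bind_id act0_dom.
Qed.

(** Requiring equal values for all larger widths and all tails makes the
    relation stable under adding strands on the right. *)
Definition weq (N : nat) (w w' : word) : Prop :=
  forall (Z : C) (n : nat), run D Z w (N + n) = run D Z w' (N + n).

Lemma arr_inj Z n p (f g : hom (pow D Z n) (pow D Z p)) : arr f = arr g -> f = g.
Proof.
rewrite /arr => -[E].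
by have := projT2_eq E; rewrite (eq_irrelevance (projT1_eq E) erefl).
Qed.

(** Strictification in the form used below: an equation between morphisms can
    be replaced by an equation between words, which mention neither
    associators nor unitors. *)
Theorem mval_weq o o' (u v : mor o o') :
  mval u = mval v <-> weq (size o) (mword u) (mword v).
Proof.
split=> [E Z n|E]; first by rewrite -heightE !run_mword E.
apply: strict_faithful; apply: arr_inj.
by rewrite -!run_mword heightE.
Qed.

Lemma weq_sym N w w' : weq N w w' -> weq N w' w. Proof. by move=> E Z n; rewrite E. Qed.
Lemma weq_trans N w w' w'' : weq N w w' -> weq N w' w'' -> weq N w w''.
Proof. by move=> E E' Z n; rewrite E. Qed.

(** k strands as a shape, for which letters shifted by k are letters under that
    shape. *)
Fixpoint strands (k : nat) : shape := if k is k'.+1 then Pair At (strands k') else One.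
Lemma size_strands k : size (strands k) = k. Proof. by elim: k => //= k ->. Qed.
Lemma height_strands k n : height (strands k) n = k + n.
Proof. by rewrite heightE size_strands. Qed.

(** The definedness of a word depends on the number of strands alone, and extra
    strands on the right do no harm. *)
Lemma run_width Z w n p : width w n = Some p ->
  forall j, exists f : hom (pow D Z (n + j)) (pow D Z (p + j)), run D Z w (n + j) = arr f.
Proof.
rewrite /width; elim: w n => [|[k g] w IH] n /=; first by move=> [->] j; exists (idm _).
rewrite {2}/letter_width /=; case: ifP => [le|_]; last first.
  by have -> : forall w', foldl (fun n0 x => obind (letter_width x) n0) None w' = None by elim.

move=> /IH/[swap] j /(_ j)[f Ef].
have [i Ei] : exists i, n = k + (ar g + i).
  by exists (n - (k + ar g)); rewrite addnA subnKC.
have En : n + j = height (strands k) (height (dom g) (i + j)).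
  by rewrite height_strands heightE Ei !addnA.
have Ep : n - ar g + coar g + j = height (strands k) (height (cod g) (i + j)).
  by rewrite height_strands heightE Ei [k + _]addnCA addKn -!addnA [i + _]addnCA.
move: (n + j) (n - _ + _ + j) En Ep f Ef => _ _ -> -> f Ef.
have := act_under D Z (strands k) 0 g (height (dom g) (i + j)).
rewrite size_strands addn0 /= act0_dom => ->.
by rewrite (bind_arr _ Ef); eexists.
Qed.

(** Rewriting inside a word.  The condition says that below the k strands on
    the left at least the N strands of the rule are present. *)
Lemma weq_ctx N l r k u v M :
  weq N l r -> fits u M (k + N) -> weq M (u ++ shift k l ++ v) (u ++ shift k r ++ v).
Proof.
rewrite /fits => E; case Ew: (width u M) => [p|] // le Z n.
have [f Ef] := run_width Z Ew n.
rewrite !(run_cat _ _ u) Ef.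
suff {f Ef} H : run D Z (shift k l) (p + n) = run D Z (shift k r) (p + n).
  by rewrite /bind /= !run_cat H.
have -> : p + n = height (strands k) (N + (p - (k + N) + n)).
  by rewrite height_strands !addnA subnKC.
have run_k w := run_under D Z (strands k) w (N + (p - (k + N) + n)).
by rewrite size_strands in run_k; rewrite !run_k E.
Qed.

Lemma weq_wider n p w w' : weq n w w' -> n <= p -> weq p w w'.
Proof. by move=> Ew le Z j; rewrite -(subnKC le) -addnA; apply: Ew. Qed.

Lemma weq_catl n p u v v' :
  width u n = Some p -> weq p v v' -> weq n (u ++ v) (u ++ v').
Proof.
move=> Eu Ev Z j; rewrite !run_cat; have [f ->] := run_width Z Eu j.
by rewrite /bind /= Ev.
Qed.

Lemma weq_catr n u u' v : weq n u u' -> weq n (u ++ v) (u' ++ v).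
Proof. by move=> Eu Z j; rewrite !run_cat Eu. Qed.

Lemma run_insert Z x w n : run D Z (insert x w) n = run D Z (x :: w) n.
Proof.
elim: w x n => [//|y w IH] x n /=; case: leqP => // le.
transitivity (run D Z [:: y, (x.1 - ar y.2 + coar y.2, x.2) & w] n).
  by rewrite /=; apply: eq_bind => p; rewrite IH.
case: x y le => [k g] [k' g'] /= le.
have [i ->] : exists i, k = k' + (ar g' + i).
  by exists (k - (k' + ar g')); rewrite addnA subnKC.
have -> : k' + (ar g' + i) - ar g' + coar g' = k' + (coar g' + i).
  by rewrite addnCA addKn -addnA [i + _]addnC.
exact: run_swap.
Qed.

Lemma run_nf Z w n : run D Z (nf w) n = run D Z w n.
Proof.
elim: w n => [//|x w IH] n; rewrite [LHS]run_insert /=.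
by apply: eq_bind => p; rewrite IH.
Qed.

Lemma weq_nf N w w' : nf w = nf w' -> weq N w w'.
Proof. by move=> E Z n; rewrite -run_nf E run_nf. Qed.

Definition rule := (nat * word * word)%type.
Definition rule_holds (r : rule) : Prop := weq r.1.1 r.1.2 r.2.
Fixpoint all_hold (rs : seq rule) : Prop :=
  if rs is r :: rs' then rule_holds r /\ all_hold rs' else True.

Lemma all_hold_cons N l r rs : weq N l r -> all_hold rs -> all_hold ((N, l, r) :: rs).
Proof. by []. Qed.

Lemma all_hold_cat rs rs' : all_hold rs -> all_hold rs' -> all_hold (rs ++ rs').
Proof. by elim: rs => //= r rs IH [H Hs] Hs'; split=> //; apply: IH. Qed.

(** One rewriting: up to interchange the word is the rule's side, moved to
    position st_pos, between st_pre and st_post. *)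
Record step := Step { st_rule : nat; st_flip : bool; st_pos : nat; st_pre : word; st_post : word }.

Definition lhs (r : rule) (b : bool) := if b then r.2 else r.1.2.

Fixpoint derivation (rs : seq rule) (N : nat) (ss : seq step) (w w' : word) : Prop :=
  match ss with
  | [::] => nf w = nf w'
  | Step i b k u v :: ss' =>
    let r := nth (0, [::], [::]) rs i in
    [/\ fits u N (k + r.1.1), nf w = nf (u ++ shift k (lhs r b) ++ v)
      & derivation rs N ss' (u ++ shift k (lhs r (~~ b)) ++ v) w']
  end.

Lemma derivation_sound rs N ss w w' : all_hold rs -> derivation rs N ss w w' -> weq N w w'.
Proof.
move=> Hrs; elim: ss w => [|[i b k u v] ss IH] w /=; first exact: weq_nf.
case=> Hfit Hnf /IH; apply: weq_trans.
apply: (weq_trans (weq_nf _ Hnf)); apply: weq_ctx Hfit.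
have: rule_holds (nth (0, [::], [::]) rs i).
  elim: rs i {Hnf IH} Hrs => [|r rs IH] [|i] //=; by [move=> [] | move=> [_ /IH]].
by rewrite /rule_holds; case: (b) => //= /weq_sym.
Qed.

End Words.

(** M is the multiplication, X the braiding, Y its inverse, T and U are t1 and
    t2, and E is e; the argument counts the strands to the left. *)
Notation M k := (k, LM).
Notation X k := (k, LC).
Notation Y k := (k, LCi).
Notation T k := (k, L1).
Notation U k := (k, L2).
Notation E k := (k, LE).

Definition letters := [:: LM; LC; LCi; L1; L2; LE].
(** Rows move the first strand to the right past q strands, columns the last
    strand to the left. *)
Definition xcol q : word := rev (xrow q).
Definition yrow q : word := [seq Y j | j <- rev (iota 0 q)].
Definition ycol q : word := rev (yrow q).

(** A strand passes a letter on either side, over or under it.  For the letters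
    X and Y these are the Yang-Baxter relations. *)
Definition naturality (g : letter) : seq rule :=
  [:: (1 + ar g, (1, g) :: xrow (coar g), xrow (ar g) ++ [:: (0, g)]);
      (1 + ar g, (0, g) :: xcol (coar g), xcol (ar g) ++ [:: (1, g)]);
      (1 + ar g, (0, g) :: yrow (coar g), yrow (ar g) ++ [:: (1, g)]);
      (1 + ar g, (1, g) :: ycol (coar g), ycol (ar g) ++ [:: (0, g)])].
Definition structural : seq rule :=
  [:: (2, [:: X 0; Y 0], [::]); (2, [:: Y 0; X 0], [::])] ++
  flatten [seq naturality g | g <- letters].

(** * Search for derivations *)

(** Nothing is proved about the functions of this part.  They produce lists of
    steps, which are checked afterwards. *)
Definition code (w : word) : seq nat :=
  flatten [seq [:: x.1; match x.2 with LM => 0 | LC => 1 | LCi => 2 | L1 => 3 | L2 => 4 | LE => 5 end] | x <- w].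
Definition same (w w' : word) := code w == code w'.

Fixpoint pull_rev (rv : word) (y : nat * letter) (acc : word) : option ((nat * letter) * word) :=
  match rv with
  | [::] => Some (y, acc)
  | x :: rv' =>
    if y.1 + ar y.2 <= x.1 then pull_rev rv' y ((x.1 - ar y.2 + coar y.2, x.2) :: acc)
    else if x.1 + coar x.2 <= y.1 then pull_rev rv' (y.1 - coar x.2 + ar x.2, y.2) (x :: acc)
    else None
  end.
(** The letter y, applied after the word v, is moved before v if possible. *)
Definition pull v y := pull_rev (rev v) y [::].

(** Occurrences of l up to interchange.  Between the letters u already placed
    before the occurrence and the letters v postponed after it stands the part
    B found so far; each further letter extends B, or is moved in front of B,
    or is postponed. *)
Fixpoint matches_from (l : word) (u B v : word) (need rest : word) (k : nat) {struct rest}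
   : seq (nat * word * word) :=
  match need with
  | [::] => [:: (k, u, v ++ rest)]
  | z :: need' =>
    match rest with
    | [::] => [::]
    | y :: rest' =>
      match pull v y with
      | None => matches_from l u B (rcons v y) need rest' k
      | Some (y1, v') =>
        if same [:: y1] [:: (k + z.1, z.2)] then
          matches_from l u (rcons B y1) v' need' rest' k
        else match pull B y1 with
        | None => matches_from l u B (rcons v y) need rest' k
        | Some (y2, B') =>
          let k' := (head (0, LM) B').1 - (head (0, LM) l).1 in
          if same B' (shift k' (take (seq.size B) l)) then
             matches_from l (rcons u y2) B' v' need rest' k'
          else matches_from l u B (rcons v y) need rest' k
        end
      end
    end
  end.

Fixpoint matches (l : word) (u w : word) : seq (nat * word * word) :=
  match l, w with
  | z :: l', x :: w' =>
    (if (same [:: (0, z.2)] [:: (0, x.2)]) && (z.1 <= x.1) then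
      matches_from l u [:: x] [::] l' w' (x.1 - z.1) else [::])
    ++ matches l (rcons u x) w'
  | _, _ => [::]
  end.

(** A finite map from coded words to derivations, to recognize visited words. *)
Inductive trie := Trie (label : option (seq step)) (children : seq trie).
Definition empty := Trie None [::].
Fixpoint lookup (x : seq nat) (t : trie) : option (seq step) :=
  let: Trie v ts := t in if x is i :: x' then lookup x' (nth empty ts i) else v.
Fixpoint store (x : seq nat) (d : seq step) (t : trie) : trie :=
  let: Trie v ts := t in
  if x is i :: x' then Trie v (set_nth empty ts i (store x' d (nth empty ts i)))
  else Trie (Some d) ts.

Definition node := (word * seq step)%type.

Definition expand (N : nat) (rs : seq rule) (nd : node) : seq node :=
  flatten [seq
    flatten [seq
      [seq (nf (kuv.1.2 ++ shift kuv.1.1 (lhs ir.2 (~~ b)) ++ kuv.2),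
            Step ir.1 b kuv.1.1 kuv.1.2 kuv.2 :: nd.2)
      | kuv <- matches (nf (lhs ir.2 b)) [::] nd.1 & fits kuv.1.2 N (kuv.1.1 + ir.2.1.1)]
    | b <- [:: false; true]]
  | ir <- zip (iota 0 (seq.size rs)) rs].

Fixpoint absorb (new front : seq node) (seen other : trie) :
    seq node * trie * option (seq step * seq step) :=
  match new with
  | [::] => (front, seen, None)
  | nd :: new' =>
    let x := code nd.1 in
    if lookup x other is Some d then (front, seen, Some (nd.2, d))
    else if lookup x seen is Some _ then absorb new' front seen other
    else absorb new' (nd :: front) (store x nd.2 seen) other
  end.

Definition flip_step s := let: Step i b k u v := s in Step i (~~ b) k u v.
Definition join d d' := Some (catrev d [seq flip_step s | s <- d']).

(** Breadth-first search from both ends, always extending the smaller front. *)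
Fixpoint bfs N (rs : seq rule) (d : nat) (f b : seq node) (sf sb : trie) : option (seq step) :=
  if d is d'.+1 then
    if ~~ nilp f && ((seq.size f <= seq.size b) || nilp b) then
      match absorb (flatten [seq expand N rs nd | nd <- f]) [::] sf sb with
      | (_, _, Some (t, t')) => join t t'
      | (f', sf', None) => bfs N rs d' f' b sf' sb
      end
    else
      match absorb (flatten [seq expand N rs nd | nd <- b]) [::] sb sf with
      | (_, _, Some (t, t')) => join t' t
      | (b', sb', None) => bfs N rs d' f b' sf sb'
      end
  else None.

Definition search N rs d w w' :=
  let a := nf w in let b := nf w' in
  if same a b then Some [::] else
  bfs N rs d [:: (a, [::])] [:: (b, [::])]
    (store (code a) [::] empty) (store (code b) [::] empty).

(** The search runs in a virtual machine and leaves only its result, so that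
    checking the proof term costs a few normal forms. *)
Ltac derive_with Hs :=
  lazymatch goal with |- weq ?D ?N ?w ?w' =>
    lazymatch type of Hs with all_hold _ ?rs =>
      let r := eval vm_compute in (search N rs 30 w w') in
      lazymatch r with
      | Some ?ss => apply (@derivation_sound _ _ rs N ss w w' Hs); vm_compute; repeat split
      | _ => fail "no derivation found"
      end
    end
  end.

(** * Rules of a braided category *)
Section Structural.
Variables (C : braided_category) (D : bialgebra_data C).

Lemma invXY : weq D 2 [:: X 0; Y 0] [::].
Proof.
move=> Z n; transitivity (arr (strict Z (raw D LCi) n ∘ strict Z (raw D LC) n)).
  by rewrite /= /bind /= comp1m.
by rewrite -strict_comp braidK (strict_id D Z (Pair At At)).
Qed.

Lemma invYX : weq D 2 [:: Y 0; X 0] [::].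
Proof.
move=> Z n; transitivity (arr (strict Z (raw D LC) n ∘ strict Z (raw D LCi) n)).
  by rewrite /= /bind /= comp1m.
by rewrite -strict_comp braidiK (strict_id D Z (Pair At At)).
Qed.

(** For the braiding this is its naturality.  The rules for the inverse follow:
    insert the braiding and its inverse on the side where the strand arrives,
    and pass the letter through. *)
Lemma naturality_holds g : all_hold D (naturality g).
Proof.
have n1 : weq D (1 + ar g) ((1, g) :: xrow (coar g)) (xrow (ar g) ++ [:: (0, g)]).
  have := iffLR (mval_weq D (Seq (Brd At (cod g)) (Par (Id At) (Ltr g)))
    (Seq (Par (Ltr g) (Id At)) (Brd At (dom g)))) (braid_nat _ _).
  by case: g.
have n2 : weq D (1 + ar g) ((0, g) :: xcol (coar g)) (xcol (ar g) ++ [:: (1, g)]).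
  have := iffLR (mval_weq D (Seq (Brd (cod g) At) (Par (Ltr g) (Id At)))
    (Seq (Par (Id At) (Ltr g)) (Brd (dom g) At))) (braid_nat _ _).
  by clear n1; case: g.
have r1 : all_hold D [:: (_, _, _); (_, _, _); (_, _, _)] :=
  conj n1 (conj invXY (conj invYX I)).
have r2 : all_hold D [:: (_, _, _); (_, _, _); (_, _, _)] :=
  conj n2 (conj invXY (conj invYX I)).
split=> //; split=> //; split; [|split=> //].
  apply: (@weq_trans _ _ _ _ (yrow (ar g) ++ xrow (ar g) ++ (0, g) :: yrow (coar g))).
    by move: r1; clear; case: g => H; derive_with H.
  by move: r1; clear; case: g => H; derive_with H.
apply: (@weq_trans _ _ _ _ (ycol (ar g) ++ xcol (ar g) ++ (1, g) :: ycol (coar g))).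
  by move: r2; clear; case: g => H; derive_with H.
by move: r2; clear; case: g => H; derive_with H.
Qed.

Lemma structural_holds : all_hold D structural.
Proof.
split; first exact: invXY.
split; first exact: invYX.
elim: letters => //= g gs IH; rewrite -cat1s.
exact: (all_hold_cat (naturality_holds g) IH).
Qed.

End Structural.

(** The opposite multiplication: the right-hand strand multiplies from the
    left. *)
Definition N k : word := [:: Y k; M k].
Definition d1w k : word := [:: Y k.+1; T k; X k.+1; M k].
Definition d2w k : word := [:: Y k; U k.+1; X k; M k.+1].
(** The map a ⊗ q ⊗ r |-> Δ²(a)(1 ⊗ q ⊗ r), and then
    a ⊗ p ⊗ q ⊗ r |-> Δ²(a)(p ⊗ q ⊗ r); a right-hand factor waits on
    the left of a until its turn. *)
Definition lambdaw k : word := [:: X k; T k.+1; Y k; T k].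
Definition delta3w k : word := X k :: lambdaw k.+1 ++ N k.

(** * Cancellation *)
Section Opposite.
Variables (C : braided_category) (A : magma C).
Lemma braidi_nat (X X' Y Y' : C) (f : hom X X') (g : hom Y Y') :
  braidi X' Y' ∘ (g ⊠ f) = (f ⊠ g) ∘ braidi X Y.
Proof.
apply: (split_mono_cancel (braidK X' Y')).
by rewrite !compA braidiK comp1m braid_nat -compA braidiK compm1.
Qed.

(** Moving the new factor from the far left to the far right, and the tail Y
    out of the way, turns the opposite multiplication on the left into the
    multiplication on the right. *)
Lemma opposite_nondegenerate : nondegenerate A ->
  forall X Y : C, injective (fun g : hom X (A ⊗ Y) =>
    ((mult A ∘ braidi A A) ⊠ idm Y) ∘ associ A A Y ∘ (idm A ⊠ g)).
Proof.
move=> nd X Y f f' E.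
have nE (g : hom X (A ⊗ Y)) :
    ((mult A ∘ braidi A A) ⊠ idm Y) ∘ associ A A Y ∘ (idm A ⊠ g) =
    braid Y A ∘ ((idm Y ⊠ mult A) ∘ assoc Y A A ∘ ((braidi Y A ∘ g) ⊠ idm A))
      ∘ braidi X A.
  have h1 := hexagon1 Y A A; have h2 := hexagon2 A Y A.
  have core : braid Y (A ⊗ A) ∘ assoc Y A A ∘ (braidi Y A ⊠ idm A) =
      associ A A Y ∘ (idm A ⊠ braid Y A) ∘ assoc A Y A.
    apply: (split_mono_cancel (assocK A A Y)).
    rewrite !compA associK comp1m h1 -!compA -tens_compl braidiK tensm1 compm1.
    by [].
  have core2 : associ A A Y ∘ (idm A ⊠ braid Y A) ∘ assoc A Y A =
      (braidi A A ⊠ idm Y) ∘ associ A A Y ∘ braid (A ⊗ Y) A.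
    apply: (split_mono_cancel (f := braid A A ⊠ idm Y) (r := braidi A A ⊠ idm Y)).
      by rewrite -tens_compl braidK tensm1.
    rewrite !compA -h2 -tens_compl braidiK tensm1 comp1m -!compA assocK compm1.
    by [].
  rewrite !compA braid_nat !tens_compl -!compA -braidi_nat.
  congr (_ ∘ _); rewrite !compA core core2 -!compA.
  by rewrite [braid _ A ∘ _]compA braidiK comp1m.
move: E; rewrite !nE => E.
apply: (split_mono_cancel (braidiK Y A)); apply: (proj1 (nd X Y)).
apply: (split_mono_cancel (braidK Y A)).
exact: (split_epi_cancel (braidK X A) E).
Qed.
End Opposite.

Section Slides.
Variables (C : braided_category) (D : bialgebra_data C).
Local Notation A := (base D).
Local Notation "w ≈[ n ] w'" := (weq D n w w') (at level 70).

(** When only one of the two outputs (or inputs) of t1 or t2 crosses a strand,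
    let the strand cross both and undo the other crossing.  These rules lengthen
    words, so they are offered to the search only where they are needed. *)
Definition slides (g : letter) : seq rule :=
  [:: (3, [:: (0, g); X 1], [:: X 1; X 0; (1, g); Y 0]);
      (3, [:: (0, g); Y 1], [:: Y 1; Y 0; (1, g); X 0]);
      (3, [:: (1, g); X 0], [:: X 0; X 1; (0, g); Y 1]);
      (3, [:: (1, g); Y 0], [:: Y 0; Y 1; (0, g); X 1]);
      (3, [:: X 1; (0, g)], [:: Y 0; (1, g); X 0; X 1]);
      (3, [:: Y 1; (0, g)], [:: X 0; (1, g); Y 0; Y 1]);
      (3, [:: X 0; (1, g)], [:: Y 1; (0, g); X 1; X 0]);
      (3, [:: Y 0; (1, g)], [:: X 1; (0, g); Y 1; Y 0])].

Lemma slides_hold g : (if g is (L1 | L2) then true else false) -> all_hold D (slides g).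
Proof.
case: g => // _; repeat split; rewrite /rule_holds /=;
by derive_with (structural_holds D).
Qed.

End Slides.

(** link proves an equation between words from the rules of a braided category
    and the listed equations; via inserts an intermediate word. *)
Ltac add_rule D H r :=
  lazymatch type of H with
  | all_hold _ _ => constr:(all_hold_cat H r)
  | _ => constr:(all_hold_cons (H : weq D _ _ _) r)
  end.
Ltac rules D Hs :=
  lazymatch Hs with
  | tt => constr:(structural_holds D)
  | (?Hs', ?H) => let r := rules D Hs' in add_rule D H r
  | ?H => let r := constr:(structural_holds D) in add_rule D H r
  end.
Tactic Notation "link" "by" constr(Hs) :=
  lazymatch goal with |- weq ?D _ _ _ => let H := rules D Hs in derive_with H end.
Tactic Notation "link" := link by tt.
Tactic Notation "via" constr(w) := apply: (@weq_trans _ _ _ _ w).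

Section Calculus.
Variables (C : braided_category) (D : bialgebra_data C).
Local Notation A := (base D).
Local Notation "w ≈[ n ] w'" := (weq D n w w') (at level 70).

Definition slides1 := @slides_hold C D L1 isT.
Definition slides2 := @slides_hold C D L2 isT.
Hypothesis asso : [:: M 0; M 0] ≈[3] [:: M 1; M 0].

Definition is_crossing (x : nat * letter) := if x.2 is (LC | LCi) then true else false.

(** Precomposing with invertible words is injective.  This is what allows to
    choose a convenient order of the input strands. *)
Lemma braid_cancel b n w w' : all (fun x => is_crossing x && (x.1.+2 <= n)) b ->
  b ++ w ≈[n] b ++ w' -> w ≈[n] w'.
Proof.
elim: b => //= -[k g] b IH /andP[/andP[gX /= le] /IH{}IH] H; apply: IH.
have fit : fits [::] n (k + 2) by rewrite /fits /= addn2.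
have cancel l v : l ≈[2] [::] -> v ≈[n] shift k l ++ v.
  move=> Hl; apply: weq_sym; exact: (weq_ctx (u := [::]) v Hl fit).
have cons_heq x v v' : x.1.+2 <= n -> is_crossing x -> v ≈[n] v' -> x :: v ≈[n] x :: v'.
  move=> lex xX Ev; apply: (@weq_catl C D n n [:: x] v v' _ Ev).
  case: x lex xX => [i [||| | |]] //= le' _; rewrite /width /= /letter_width /= addn2 le' /=;
  by rewrite subnK // (leq_trans _ le').
case: g gX H => // _ H.
  apply: (weq_trans (cancel [:: Y 0; X 0] _ (invYX _))).
  apply: (weq_trans _ (weq_sym (cancel [:: Y 0; X 0] _ (invYX _)))).
  rewrite /= addn0; exact: cons_heq.
apply: (weq_trans (cancel [:: X 0; Y 0] _ (invXY _))).
apply: (weq_trans _ (weq_sym (cancel [:: X 0; Y 0] _ (invXY _)))).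
rewrite /= addn0; exact: cons_heq.
Qed.

Lemma opp_assoc : N 0 ++ N 0 ≈[3] N 1 ++ N 0.
Proof. link by asso. Qed.

Lemma opp_mul : N 1 ++ [:: M 0] ≈[3] [:: X 0; M 1] ++ N 0.
Proof. link by asso. Qed.

(** A right-hand factor of Δ(a), once moved to the left of a, acts through the
    opposite multiplication. *)
Lemma d1_alt : d1w 0 ≈[3] [:: X 0; T 1] ++ N 0.
Proof. link by slides1. Qed.
Lemma d2_alt : d2w 0 ≈[3] [:: X 1; U 0] ++ N 1.
Proof. link by slides2. Qed.

Lemma strict_mul Z n : strict Z (raw D LM) n = (mult A ⊠ idm _) ∘ associ _ _ _.
Proof. by rewrite /strict /= comp1m tensm1 !compm1. Qed.

Lemma strict_opp_mul Z n : strict Z (raw D LM) n ∘ strict Z (raw D LCi) n =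
  ((mult A ∘ braidi A A) ⊠ idm _) ∘ associ _ _ _.
Proof.
rewrite strict_mul /strict /= tensm1 !comp1m !compm1 -!compA [associ _ _ _ ∘ _]compA.
by rewrite assocK comp1m tens_compl compA.
Qed.

Hypothesis nondeg : nondegenerate (base D).

(** The hypotheses on width say that w and w' leave the same number of strands,
    among them the one that gets multiplied. *)
Lemma cancel_mul n p w w' :
  shift 1 w ++ [:: M 0] ≈[n.+1] shift 1 w' ++ [:: M 0] ->
  width w n = Some p.+1 -> width w' n = Some p.+1 -> w ≈[n] w'.
Proof.
move=> H Ew Ew' Z j; have [f Ef] := run_width D Z Ew j; have [f' Ef'] := run_width D Z Ew' j.
have := H Z j; rewrite !run_cat !(run_under D Z At w (n + j)) !(run_under D Z At w' (n + j)) Ef Ef'.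
rewrite /bind /= !comp1m => /arr_inj; rewrite strict_mul => /(proj2 (nondeg _ _)) ->.
by [].
Qed.

Lemma cancel_opp n p w w' :
  shift 1 w ++ N 0 ≈[n.+1] shift 1 w' ++ N 0 ->
  width w n = Some p.+1 -> width w' n = Some p.+1 -> w ≈[n] w'.
Proof.
move=> H Ew Ew' Z j; have [f Ef] := run_width D Z Ew j; have [f' Ef'] := run_width D Z Ew' j.
have := H Z j; rewrite !run_cat !(run_under D Z At w (n + j)) !(run_under D Z At w' (n + j)) Ef Ef'.
rewrite /bind /= !comp1m => /arr_inj; rewrite strict_opp_mul.
by move=> /(opposite_nondegenerate nondeg) ->.
Qed.

(** * Linearity of t1 and multiplicativity of d1 *)
Hypothesis exch : [:: T 1; M 0] ≈[3] [:: U 0; M 1].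

(** Multiply the first output by x on the left.  By the exchange law t1 becomes
    t2(x ⊗ a) with bc, or with b and then c, multiplied onto its second
    output, and these agree by associativity. *)
Lemma t1_linear : [:: M 1; T 0] ≈[3] [:: T 0; M 1].
Proof. apply: cancel_mul => //; link by (asso, exch). Qed.

Lemma t1_linear_opp : N 1 ++ [:: T 0] ≈[3] [:: X 0; T 1; Y 0] ++ N 1.
Proof. link by (t1_linear, slides1). Qed.

(** Linearity in the middle factor: it inserts a factor q into the second leg
    of Δ²(a), on the right. *)
Lemma lambda_linear_opp : N 1 ++ lambdaw 0 ≈[4] [:: X 0] ++ lambdaw 1 ++ [:: Y 0] ++ N 1.
Proof. link by t1_linear_opp. Qed.

Definition fusion_eq := [:: T 1] ++ lambdaw 0 ≈[3] [:: T 0; T 1].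
Definition product_rule := [:: M 0; T 0] ≈[3] [:: T 1] ++ d1w 0.

(** Both sides are an opposite product with the third input, applied to the two sides of the
    product rule; in the other direction this product is cancelled. *)
Lemma d1_of_product_rule : product_rule -> d1w 1 ++ d1w 0 ≈[4] M 0 :: d1w 0.
Proof. move=> mul; link by (mul, d1_alt, opp_assoc). Qed.
Lemma product_rule_of_d1 : d1w 1 ++ d1w 0 ≈[4] M 0 :: d1w 0 -> product_rule.
Proof.
move=> mul; apply: cancel_opp => //.
via ([:: Y 0; Y 1] ++ d1w 1 ++ d1w 0); last link by (d1_alt, opp_assoc).
link by (mul, d1_alt). Qed.

(** * The exchange law *)

(** The multiplication of A ⊗ A, and further below that of a triple product. *)
Definition mul2w k : word := [:: X k.+1; M k; M k.+1].

(** The inputs x, y, a, b, c are reordered to b, x, a, c, y.  Then b acts on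
    the left end and y on the right end, each through the opposite
    multiplication, and the exchange law is left in the middle. *)
Lemma Mmorphism_lhs :
   [:: Y 0; Y 1; Y 3; Y 2; Y 1] ++ d1w 2 ++ mul2w 0 ≈[5] [:: T 2; M 1] ++ N 0 ++ N 1.
Proof.
via ([:: Y 0; Y 1; Y 3; Y 2; Y 1; X 2; T 3] ++ N 2 ++ mul2w 0); first link by d1_alt.
link by asso.
Qed.
Lemma Mmorphism_rhs :
   [:: Y 0; Y 1; Y 3; Y 2; Y 1] ++ d2w 0 ++ mul2w 0 ≈[5] [:: U 1; M 2] ++ N 0 ++ N 1.
Proof.
via ([:: Y 0; Y 1; Y 3; Y 2; Y 1; X 1; U 0] ++ N 1 ++ mul2w 0); first link by d2_alt.
link by asso.
Qed.

Lemma Mmorphism_of_exchange : d1w 2 ++ mul2w 0 ≈[5] d2w 0 ++ mul2w 0.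
Proof.
apply: (@braid_cancel [:: Y 0; Y 1; Y 3; Y 2; Y 1]) => //.
link by (Mmorphism_lhs, Mmorphism_rhs, exch).
Qed.

(** Cancelling in the second output strand, by moving it to the front. *)
Lemma cancel_mul_mid n p w w' :
  shift 1 w ++ [:: X 0; M 1] ≈[n.+1] shift 1 w' ++ [:: X 0; M 1] ->
  width w n = Some p.+2 -> width w' n = Some p.+2 -> w ≈[n] w'.
Proof.
move=> H Ew Ew'.
have step v : width v n = Some p.+2 ->
    shift 1 (v ++ [:: Y 0]) ++ [:: M 0] ≈[n.+1] (shift 1 v ++ [:: X 0; M 1]) ++ [:: Y 0].
  move=> Ev; rewrite shift_cat -!catA; apply: (weq_catl (width_shift 1 Ev)).
  by apply: (@weq_wider _ _ 3) => //; link.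
have H' : w ++ [:: Y 0] ≈[n] w' ++ [:: Y 0].
  have wY v : width v n = Some p.+2 -> width (v ++ [:: Y 0]) n = Some p.+2.
    by move/width_cat->; rewrite width_cons /letter_width /= subn2 addn2.
  apply: cancel_mul (wY _ Ew) (wY _ Ew').
  apply: (weq_trans (step _ Ew)); apply: (weq_trans _ (weq_sym (step _ Ew'))).
  exact: weq_catr.
have back v : width v n = Some p.+2 -> v ≈[n] (v ++ [:: Y 0]) ++ [:: X 0].
  move=> Ev; rewrite -catA -{1}(cats0 v); apply: (weq_catl Ev).
  by apply: (@weq_wider _ _ 2) => //; apply: weq_sym; exact: invYX.
apply: (weq_trans (back _ Ew)); apply: (weq_trans _ (weq_sym (back _ Ew'))).
exact: weq_catr.
Qed.

Lemma cancel_opp_mid n p w w' :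
  shift 1 w ++ ([:: Y 0] ++ N 1) ≈[n.+1] shift 1 w' ++ ([:: Y 0] ++ N 1) ->
  width w n = Some p.+2 -> width w' n = Some p.+2 -> w ≈[n] w'.
Proof.
move=> H Ew Ew'.
have step v : width v n = Some p.+2 ->
    shift 1 (v ++ [:: X 0]) ++ N 0 ≈[n.+1] (shift 1 v ++ ([:: Y 0] ++ N 1)) ++ [:: X 0].
  move=> Ev; rewrite shift_cat -!catA; apply: (weq_catl (width_shift 1 Ev)).
  by apply: (@weq_wider _ _ 3) => //; link.
have H' : w ++ [:: X 0] ≈[n] w' ++ [:: X 0].
  have wY v : width v n = Some p.+2 -> width (v ++ [:: X 0]) n = Some p.+2.
    by move/width_cat->; rewrite width_cons /letter_width /= subn2 addn2.
  apply: cancel_opp (wY _ Ew) (wY _ Ew').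
  apply: (weq_trans (step _ Ew)); apply: (weq_trans _ (weq_sym (step _ Ew'))).
  exact: weq_catr.
have back v : width v n = Some p.+2 -> v ≈[n] (v ++ [:: X 0]) ++ [:: Y 0].
  move=> Ev; rewrite -catA -{1}(cats0 v); apply: (weq_catl Ev).
  by apply: (@weq_wider _ _ 2) => //; apply: weq_sym; exact: invXY.
apply: (weq_trans (back _ Ew)); apply: (weq_trans _ (weq_sym (back _ Ew'))).
exact: weq_catr.
Qed.

Lemma exchange_of_Mmorphism : d1w 2 ++ mul2w 0 ≈[5] d2w 0 ++ mul2w 0 -> [:: T 1; M 0] ≈[3] [:: U 0; M 1].
Proof.
move=> dm.
suff H : [:: T 1; M 0] ++ N 1 ≈[4] [:: U 0; M 1] ++ N 1.
  apply: cancel_mul_mid => //.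
  via ([:: X 0; X 1; X 2; T 1; M 0] ++ N 1); first link.
  via ([:: X 0; X 1; X 2; U 0; M 1] ++ N 1); last link.
  link by H.
apply: cancel_opp => //.
via ([:: T 2; M 1] ++ N 0 ++ N 1); first link.
via ([:: U 1; M 2] ++ N 0 ++ N 1); last link.
via ([:: Y 0; Y 1; Y 3; Y 2; Y 1] ++ d1w 2 ++ mul2w 0); first link by Mmorphism_lhs.
via ([:: Y 0; Y 1; Y 3; Y 2; Y 1] ++ d2w 0 ++ mul2w 0); last link by Mmorphism_rhs.
link by dm.
Qed.

(** * Coassociativity and the fusion equation *)

(** Here Δ²(a)(p ⊗ q ⊗ r) is read as Δ(a')(p ⊗ q) ⊗ a'' with
    a' ⊗ a'' = Δ(a)(1 ⊗ r). *)
Lemma delta3w_alt : delta3w 0 ≈[4] [:: Y 2; Y 1; T 0; X 1; X 2] ++ d1w 0.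
Proof. link by (d1_alt, slides1). Qed.

Lemma d1_crossing : [:: X 0; X 1; X 2] ++ d1w 0 ≈[4] d1w 1 ++ [:: X 0; X 1].
Proof. link. Qed.

Lemma t1_strand_linear : [:: X 1; X 2; M 3; Y 2; Y 1; T 0; X 1; X 2] ≈[5] [:: T 0; X 1; X 2; M 3].
Proof. link by t1_linear. Qed.

(** The composite through Δ ⊗ 1: both sides are
    Δ(a')Δ(b)(p ⊗ q) ⊗ a''c r where a' ⊗ a'' stands for Δ(a).  On the right
    this needs Δ(a'b) = Δ(a')Δ(b), on the left linearity of t1. *)
Lemma left_comult (mul : product_rule) :
  [:: X 2; X 3] ++ d1w 1 ++ [:: M 3] ++ delta3w 0 ≈[6] d1w 0 ++ [:: X 1; X 2] ++ d1w 0 ++ [:: M 2].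
Proof.
via ([:: Y 1; T 0] ++ d1w 2 ++ [:: X 1; X 2] ++ d1w 0 ++ [:: M 2]).
  via ([:: X 2; X 3] ++ d1w 1 ++ [:: M 3] ++ [:: Y 2; Y 1; T 0; X 1; X 2] ++ d1w 0).
    link by delta3w_alt.
  via ([:: Y 1] ++ d1w 2 ++ [:: X 1; X 2] ++ [:: M 3] ++ [:: Y 2; Y 1; T 0; X 1; X 2] ++ d1w 0).
    link by d1_crossing.
  link by t1_strand_linear.
have dm := d1_of_product_rule mul.
via ([:: Y 1; T 0; X 1; M 0; X 1; X 2] ++ d1w 0 ++ [:: M 2]); last link.
via ([:: Y 1; T 0; X 1; X 2; X 3; M 0] ++ d1w 0 ++ [:: M 2]); last link.
link by (dm, d1_crossing).
Qed.

(** The part in which the two sides of the right-hand comultiplicativity differ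
    is a pair of words on three strands, the two sides of the fusion equation. *)
Definition right_comult_core w := [:: X 0; X 2; X 1; M 0; X 2; X 1] ++ shift 2 w ++ [:: Y 1] ++ N 2 ++ N 0.

Lemma right_comult_rhs : d1w 0 ++ [:: X 1; M 0] ++ d1w 1 ≈[6] right_comult_core [:: T 0; T 1].
Proof.
via ([:: X 0; T 1] ++ N 0 ++ [:: X 1; M 0] ++ [:: X 1; T 2] ++ N 1).
  link by d1_alt.
via ([:: X 0; T 1; X 2; X 1; M 0] ++ N 0 ++ [:: X 1; T 2] ++ N 1).
  link by (asso, opp_mul, opp_assoc).
via ([:: X 0; X 2; X 1; M 0; T 1; X 2; T 3] ++ N 2 ++ N 0).
  link.
link by slides1.
Qed.

Lemma right_comult_lhs : [:: X 2; M 1] ++ d1w 2 ++ delta3w 0 ≈[6] right_comult_core ([:: T 1] ++ lambdaw 0).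
Proof.
via ([:: X 2; M 1] ++ [:: X 2; T 3] ++ N 2 ++ delta3w 0).
  link by d1_alt.
via ([:: X 0; X 2; X 1; M 0; X 2; T 3] ++ N 2 ++ lambdaw 1 ++ N 0); first link.
link by lambda_linear_opp.
Qed.

(** * The iterated comultiplication is an M-morphism *)

(** The reversals of lambdaw and delta3w, with t2 in place of t1. *)
Definition lambdaw' k : word := [:: X k.+1; U k; Y k.+1; U k.+1].
Definition delta3w' k : word := X k.+2 :: lambdaw' k ++ N k.+2.
Definition mul3w : word := [:: X 2; X 3] ++ mul2w 0 ++ [:: M 2].

(** The exchange law multiplied by y on its second leg, where t2 appears with
    the factor y on the left of that leg. *)
Lemma exchange_left_factor : [:: T 2; X 1; M 0; M 1] ≈[4] [:: X 1; U 0] ++ N 1 ++ [:: M 1].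
Proof.
link by (asso, exch, slides1).
Qed.
Lemma exchange_right_factor : [:: U 0; X 1; M 0; M 1] ≈[4] [:: X 1; T 2] ++ N 1 ++ [:: M 0].
Proof.
link by (asso, exch, slides2).
Qed.

(** Each of the two blocks has an extra strand passing through its letter.
    These strands can instead pass outside, on the left for t2 and on the right
    for t1, and then t1 and t2 meet as in the hypothesis. *)
Lemma commute_across (comm : [:: T 1; U 0] ≈[3] [:: U 0; T 1]) :
  [:: X 2; T 3; Y 2; X 1; U 0; Y 1] ≈[5] [:: X 1; U 0; Y 1; X 2; T 3; Y 2].
Proof.
via [:: Y 3; Y 0; T 2; U 1; X 0; X 3]; first link by (slides1, slides2).
via [:: Y 3; Y 0; U 1; T 2; X 0; X 3]; last link by (slides1, slides2).
link by comm.
Qed.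

(** What remains of the M-morphism equation without p and z: both sides are
    x a' ⊗ y a'' q ⊗ a''' r for Δ²(a) = a' ⊗ a'' ⊗ a'''. *)
Lemma delta3_core (comm : [:: T 1; U 0] ≈[3] [:: U 0; T 1]) :
  lambdaw 2 ++ [:: X 1; M 0; M 1] ≈[5] lambdaw' 0 ++ [:: X 2; M 1; M 2].
Proof.
via ([:: X 2; T 3; Y 2; X 1; U 0; Y 1; M 1; M 1]).
  link by (exchange_left_factor, asso).
via ([:: X 1; U 0; Y 1; X 2; T 3; Y 2; M 1; M 1]).
  link by (commute_across comm).
link by (exchange_right_factor, asso).
Qed.

(** As for the comultiplication itself, p is moved to the far left and z to the
    far right, where they act through the opposite multiplication. *)
Lemma delta3w_lhs : [:: Y 0; Y 1; Y 2; Y 5; Y 4; Y 3; Y 2] ++ delta3w 3 ++ mul3w ≈[7]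
  shift 1 (lambdaw 2 ++ [:: X 1; M 0; M 1]) ++ N 3 ++ N 0.
Proof.
via (lambdaw 3 ++ [:: Y 5; Y 4; Y 3; Y 0; Y 1; Y 2] ++ N 3 ++ mul3w).
  link by (slides1).
via (lambdaw 3 ++ [:: Y 0; Y 1] ++ N 2 ++ [:: X 1; M 0; M 1] ++ N 2).
  link.
link by opp_mul.
Qed.
Lemma delta3w_rhs : [:: Y 0; Y 1; Y 2; Y 5; Y 4; Y 3; Y 2] ++ delta3w' 0 ++ mul3w ≈[7]
  shift 1 (lambdaw' 0 ++ [:: X 2; M 1; M 2]) ++ N 3 ++ N 0.
Proof.
via (lambdaw' 1 ++ [:: Y 0; Y 1; Y 2; Y 5; Y 4; Y 3] ++ N 2 ++ mul3w).
  link by (slides2).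
via (lambdaw' 1 ++ [:: X 3; Y 5] ++ N 4 ++ [:: M 4; M 2] ++ N 0).
  link.
link by asso.
Qed.

Lemma delta3w_Mmorphism (comm : [:: T 1; U 0] ≈[3] [:: U 0; T 1]) : delta3w 3 ++ mul3w ≈[7] delta3w' 0 ++ mul3w.
Proof.
apply: (@braid_cancel [:: Y 0; Y 1; Y 2; Y 5; Y 4; Y 3; Y 2]) => //.
link by (delta3w_lhs, delta3w_rhs, delta3_core comm).
Qed.

Hypothesis emul : [:: M 0; E 0] ≈[2] [:: E 0; E 0].

(** * Counit laws and commutation of t1 with t2 *)
Lemma counit_left : [:: T 0; E 0] ≈[2] [:: M 0] ->
  [:: E 1; M 1; M 0] ≈[4] d1w 0 ++ [:: E 0; M 0].
Proof.
move=> H; link by (H, emul, asso).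
Qed.
Lemma counit_right : [:: T 0; E 1] ≈[2] [:: E 1] ->
  [:: X 2; M 1; E 2; M 0] ≈[4] d1w 0 ++ [:: X 1; M 0; E 1].
Proof.
move=> H; link by (H, asso).
Qed.

Lemma of_counit_left :
  [:: E 1; M 1; M 0] ≈[4] d1w 0 ++ [:: E 0; M 0] ->  [:: E 1; M 0] ≈[3] [:: E 1; T 0; E 0].
Proof.
move=> H; apply: cancel_opp => //=.
via ([:: Y 0; Y 1; Y 2] ++ [:: E 1; M 1; M 0]); first link by asso.
via ([:: Y 0; Y 1; Y 2] ++ d1w 0 ++ [:: E 0; M 0]); first link by H.
link by (H, emul).
Qed.
Lemma of_counit_right :
  [:: X 2; M 1; E 2; M 0] ≈[4] d1w 0 ++ [:: X 1; M 0; E 1] -> [:: T 0; E 1] ≈[2] [:: E 1].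
Proof.
move=> H.
have H' : [:: M 0; E 1] ≈[3] d1w 0 ++ [:: E 1].
  apply: cancel_opp => //=.
  via ([:: Y 0; Y 1; Y 2] ++ [:: X 2; M 1; E 2; M 0]); first link by asso.
  via ([:: Y 0; Y 1; Y 2] ++ d1w 0 ++ [:: X 1; M 0; E 1]); first link by H.
  link.
apply: cancel_opp => //=.
via ([:: Y 0; M 0; E 1]); last link.
via ([:: Y 0] ++ d1w 0 ++ [:: E 1]); last link by H'.
link by d1_alt.
Qed.

(** Apply e to the first output of the fusion equation. *)
Lemma product_rule_of_fusion : fusion_eq -> [:: T 0; E 0] ≈[2] [:: M 0] -> product_rule.
Proof.
move=> f H. via [:: T 0; T 1; E 0]. link by H.
via ([:: T 1] ++ lambdaw 0 ++ [:: E 0]); first link by f.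
link by (H, slides1).
Qed.

(** Apply e to the middle output. *)
Lemma exchange_of_commutation : [:: T 1; U 0] ≈[3] [:: U 0; T 1] -> [:: T 0; E 0] ≈[2] [:: M 0] -> [:: U 0; E 1] ≈[2] [:: M 0] ->
  [:: T 1; M 0] ≈[3] [:: U 0; M 1].
Proof.
move=> c H H'. via [:: T 1; U 0; E 1]. link by H'.
via [:: U 0; T 1; E 1]; first link by c.
link by H.
Qed.

(** The result of v with its middle output multiplied on the right by a further
    input. *)
Definition mulmid v : word := [:: Y 2] ++ v ++ [:: X 2; M 1].

(** Multiply both sides of the fusion equation by x on the left.  By the
    exchange law, and on one side by the product rule, this becomes the desired
    commutation, under mulmid, with its last two inputs replaced by t1(b, c). *)
Lemma commutation_times_t1 (f : fusion_eq) (mul : product_rule) :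
  [:: T 2] ++ mulmid [:: T 1; U 0] ≈[4] [:: T 2] ++ mulmid [:: U 0; T 1].
Proof.
via ([:: T 2] ++ lambdaw 1 ++ [:: M 0]).
  link by (exch, slides1).
via ([:: T 1; T 2; M 0]); first link by f.
via ([:: U 0; M 1; T 1]); first link by exch.
via ([:: U 0; T 2] ++ d1w 1); first link by mul.
link by (d1_alt, slides1).
Qed.

Lemma mulmid_linear1 : [:: M 2; Y 2; T 1; U 0; X 2; M 1] ≈[5] [:: Y 3; Y 2; T 1; U 0; X 2; M 1; X 2; M 1].
Proof. link by asso. Qed.
Lemma mulmid_linear2 : [:: M 2; Y 2; U 0; T 1; X 2; M 1] ≈[5] [:: Y 3; Y 2; U 0; T 1; X 2; M 1; X 2; M 1].
Proof. link by asso. Qed.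

(** Since mulmid is linear in its further input, t1(b, c) may be replaced by
    Δ(b)(b' ⊗ c), that is by d1, which is an epimorphism. *)
Lemma commutation_times_d1 (f : fusion_eq) (mul : product_rule) :
  d1w 2 ++ mulmid [:: T 1; U 0] ≈[5] d1w 2 ++ mulmid [:: U 0; T 1].
Proof.
have st := commutation_times_t1 f mul.
via ([:: Y 3; T 2; Y 2; T 1; U 0; X 2; M 1; X 2; M 1]).
  link by mulmid_linear1.
via ([:: Y 3; T 2; Y 2; U 0; T 1; X 2; M 1; X 2; M 1]).
  link by st.
link by mulmid_linear2.
Qed.

Lemma commutation_of_mulmid :
  mulmid [:: T 1; U 0] ≈[4] mulmid [:: U 0; T 1] -> [:: T 1; U 0] ≈[3] [:: U 0; T 1].
Proof.
move/(@braid_cancel [:: Y 2]) => H.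
have {}H := H isT.
apply: cancel_opp_mid => //.
via ([:: Y 0; Y 1; Y 2; T 1; U 0; X 2; M 1]); first link.
via ([:: Y 0; Y 1; Y 2; U 0; T 1; X 2; M 1]); last link.
link by H.
Qed.

Lemma fusion_core_cancel (w w' : word) :
  shift 2 w ++ [:: Y 1] ++ N 2 ++ N 0 ≈[5] shift 2 w' ++ [:: Y 1] ++ N 2 ++ N 0 ->
  width w 3 = Some 3 -> width w' 3 = Some 3 -> w ≈[3] w'.
Proof.
move=> H Ew Ew'; apply: cancel_opp_mid (Ew) (Ew').
have wide v : width v 3 = Some 3 -> width (shift 1 v ++ [:: Y 0] ++ N 1) 4 = Some 3.
  by move/(width_shift 1)/width_cat ->.
apply: cancel_opp (wide _ Ew) (wide _ Ew').
have step v : width v 3 = Some 3 ->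
  shift 1 (shift 1 v ++ [:: Y 0] ++ N 1) ++ N 0 ≈[5] shift 2 v ++ [:: Y 1] ++ N 2 ++ N 0.
  move=> Ev; rewrite shift_cat shiftD -catA; apply: (weq_catl (width_shift 2 Ev)).
  link.
apply: (weq_trans (step _ Ew)); apply: (weq_trans _ (weq_sym (step _ Ew'))).
exact: H.
Qed.

End Calculus.

(** * Epimorphisms in the class Q *)
Section Epi.
Variables (C : braided_category) (Q : epi_class C).

Lemma Q_epi (X Y Z : C) (f : hom X Y) (g h : hom Y Z) :
  inQ Q f -> g ∘ f = h ∘ f -> g = h.
Proof.
move=> /Q_regular[W [p [q [E univ]]]] gh.
have [|k [_ uk]] := univ _ (g ∘ f); first by rewrite -!compA E.
by rewrite -(uk g) // (uk h).
Qed.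

Lemma Q_id (X : C) : inQ Q (idm X).
Proof. by apply: Q_iso; exists (idm X); rewrite comp1m. Qed.

Variable D : bialgebra_data C.

Lemma Q_strict Z o o' (f : hom (obj_of D o) (obj_of D o')) n :
  inQ Q f -> inQ Q (strict Z f n).
Proof.
move=> Qf; apply: Q_comp; [apply: Q_comp; [|exact: Q_tens Qf (Q_id _)]|];
  apply: Q_iso; [exists (flati D Z o' n)|exists (flat D Z o n)];
  by rewrite flatK flatiK.
Qed.

Lemma Q_under Z o n p (f : hom (pow D Z n) (pow D Z p)) :
  inQ Q f -> inQ Q (under o f).
Proof.
move=> Qf; elim: o n p f Qf => //= [n p f Qf|o IH o' IH' n p f Qf].
  exact: Q_tens (Q_id _) Qf.
exact/IH/IH'.
Qed.

(** Idle strands keep a morphism in Q, hence an epimorphism, so it can be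
    cancelled at any position of a word. *)
Lemma epi_cancel o o' (u : mor o o') k j w w' :
  inQ Q (mval D u) ->
  weq D (k + (size o + j)) (shift k (mword u) ++ w) (shift k (mword u) ++ w') ->
  weq D (k + (size o' + j)) w w'.
Proof.
move=> Qu H Z n; have {H} := H Z n.
have eq_h p : k + (size p + j) + n = height (strands k) (height p (j + n)).
  by rewrite height_strands heightE !addnA.
rewrite !eq_h !run_cat.
have -> : run D Z (shift k (mword u)) (height (strands k) (height o (j + n))) =
  arr (under (strands k) (strict Z (mval D u) (j + n))).
  by have := run_under D Z (strands k) (mword u) (height o (j + n)); rewrite size_strands run_mword.
have := Q_under (strands k) (Q_strict Z (j + n) Qu).
move: (under _ _) => q Qq; rewrite /bind /=.
case: run => [[p f]|]; case: run => [[p' f']|] //= E.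
have Ep : p = p' by case: E.
by move: f' E; rewrite -Ep => f' /arr_inj/(Q_epi Qq) ->.
Qed.

End Epi.

(** * First components *)

(** words D turns an equation between morphisms into the equation between their
    words.  Every object other than a tensor product or the unit is read as
    the base of D. *)
Ltac quote_shape X :=
  lazymatch X with
  | munit => constr:(One)
  | tens ?X ?Y => let o := quote_shape X in let p := quote_shape Y in constr:(Pair o p)
  | _ => constr:(At)
  end.

Ltac quote D f :=
  lazymatch f with
  | idm ?X => let o := quote_shape X in constr:(Id o)
  | comp ?g ?f => let v := quote D g in let u := quote D f in constr:(Seq v u)
  | tensm ?f ?g => let u := quote D f in let v := quote D g in constr:(Par u v)
  | assoc ?X ?Y ?Z =>
    let o := quote_shape X in let p := quote_shape Y in let q := quote_shape Z in
    constr:(Ass o p q)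
  | associ ?X ?Y ?Z =>
    let o := quote_shape X in let p := quote_shape Y in let q := quote_shape Z in
    constr:(Assi o p q)
  | lunit ?X => let o := quote_shape X in constr:(Lun o)
  | luniti ?X => let o := quote_shape X in constr:(Luni o)
  | runit ?X => let o := quote_shape X in constr:(Run o)
  | runiti ?X => let o := quote_shape X in constr:(Runi o)
  | braid ?X ?Y => let o := quote_shape X in let p := quote_shape Y in constr:(Brd o p)
  | braidi _ _ => constr:(Ltr LCi)
  | mult _ => constr:(Ltr LM)
  | ?f =>
    let g := match f with
      | _ => let _ := constr:(erefl : f = op1 D) in constr:(L1)
      | _ => let _ := constr:(erefl : f = op2 D) in constr:(L2)
      | _ => let _ := constr:(erefl : f = ope D) in constr:(LE)
      end in constr:(Ltr g)
  end.

Tactic Notation "words" constr(D) :=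
  lazymatch goal with |- ?f = ?g =>
    let u := quote D f in let v := quote D g in
    apply (proj2 (mval_weq D u v))
  end.

Tactic Notation "words" constr(D) "in" hyp(H) :=
  lazymatch type of H with ?f = ?g =>
    let u := quote D f in let v := quote D g in
    apply (proj1 (mval_weq D u v)) in H
  end.

Section QuotedD1.
Variables (C : braided_category) (A : magma C) (t1 t2 : hom (A ⊗ A) (A ⊗ A)) (e : hom A munit).
Local Notation D := (Data t1 t2 e).

Lemma d1_words : exists u : mor (Pair At (Pair At At)) (Pair At At),
  mval D u = d1 t1 (mult A) /\ mword u = d1w 0.
Proof.
rewrite /d1 /on12.
match goal with |- exists u, mval ?D u = ?f /\ _ => let u := quote D f in exists u end.
by split.
Qed.

End QuotedD1.

(** The equation by which the first component h of the composite of f followed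
    by g is characterized. *)
Definition fst_composite (C : braided_category) (A B D : C)
    (g : hom (B ⊗ D) D) (f : hom (A ⊗ B) B) (h : hom (A ⊗ D) D) : Prop :=
  h ∘ (idm A ⊠ g) ∘ assoc A B D = g ∘ (f ⊠ idm D).

Section Half.
Variables (C : braided_category) (A : magma C).
Variables (t1 : hom (A ⊗ A) (A ⊗ A)) (e : hom A munit).
Local Notation m := (mult A).
Local Notation c := (braid A A).
Local Notation ci := (braidi A A).

(** The morphism whose word is lambdaw. *)
Definition lambda : hom (A ⊗ (A ⊗ A)) (A ⊗ (A ⊗ A)) :=
  on12 A t1 ∘ on12 A ci ∘ (idm A ⊠ t1) ∘ on12 A c.

(** The first component of the iterated comultiplication, with target
    A ⊗ (A ⊗ A), and delta3l the same with target (A ⊗ A) ⊗ A. *)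
Definition delta3 : hom (A ⊗ (A ⊗ (A ⊗ A))) (A ⊗ (A ⊗ A)) :=
  ((m ∘ ci) ⊠ idm (A ⊗ A)) ∘ associ A A (A ⊗ A) ∘ (idm A ⊠ lambda) ∘ on12 (A ⊗ A) c.

Definition delta3l : hom (A ⊗ ((A ⊗ A) ⊗ A)) ((A ⊗ A) ⊗ A) :=
  associ A A A ∘ delta3 ∘ (idm A ⊠ assoc A A A).

Local Notation prod1 f g W X Y Z := ((f ⊠ g) ∘ middle4 W X Y Z).

Definition first_multiplicative : Prop :=
  d1 t1 m ∘ (idm A ⊠ d1 t1 m) ∘ assoc A A (A ⊗ A) = d1 t1 m ∘ (m ⊠ idm (A ⊗ A)).

(** In the first law delta3 is the first component of the composite through
    1 ⊗ Δ, in the second of the composite through Δ ⊗ 1. *)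
Definition first_right_comultiplicative : Prop :=
  fst_composite (prod1 m (d1 t1 m) A A A (A ⊗ A)) (d1 t1 m) delta3.

Definition first_left_comultiplicative : Prop :=
  fst_composite (prod1 (d1 t1 m) m A A (A ⊗ A) A) (d1 t1 m) delta3l.

Definition first_left_counital : Prop :=
  fst_composite (prod1 (e ∘ runit A) m A A munit A) (d1 t1 m)
    (luniti A ∘ m ∘ (idm A ⊠ lunit A)).

Definition first_right_counital : Prop :=
  fst_composite (prod1 m (e ∘ runit A) A A A munit) (d1 t1 m)
    (runiti A ∘ m ∘ (idm A ⊠ runit A)).

Definition counit_multiplicative : Prop := e ∘ m = e ∘ lunit A ∘ (e ⊠ idm A).

End Half.

Ltac unfold_raw :=
  rewrite /first_multiplicative /first_right_comultiplicative /first_left_comultiplicative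
    /first_left_counital /first_right_counital /counit_multiplicative /fst_composite
    /delta3l /delta3 /lambda /is_Mmorphism /= /d1 /d2 /middle4 /on12 /=.

Section Halves.
Variables (C : braided_category) (Q : epi_class C) (A : magma C).
Variables (t1 t2 : hom (A ⊗ A) (A ⊗ A)) (e : hom A munit).
Local Notation D := (Data t1 t2 e).
Local Notation m := (mult A).

Lemma is_semigroup_words : is_semigroup A -> weq D 3 [:: M 0; M 0] [:: M 1; M 0].
Proof. by rewrite /is_semigroup => H; words D in H. Qed.

Lemma counit_multiplicative_words :
  counit_multiplicative e -> weq D 2 [:: M 0; E 0] [:: E 0; E 0].
Proof. by unfold_raw => H; words D in H. Qed.

Lemma comult_is_Mmorphism_words :
  is_Mmorphism (comult_pair t1 t2) <-> weq D 5 (d1w 2 ++ mul2w 0) (d2w 0 ++ mul2w 0).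
Proof.
split.
  unfold_raw => H; words D in H.
  link by H.
move=> H; unfold_raw; words D.
link by H.
Qed.

Lemma first_multiplicative_words :
  first_multiplicative t1 <-> weq D 4 (d1w 1 ++ d1w 0) (M 0 :: d1w 0).
Proof.
split; unfold_raw => H.
  words D in H; link by H.
by words D; link by H.
Qed.

Lemma first_right_comultiplicative_words :
  first_right_comultiplicative t1 <->
  weq D 6 ([:: X 2; M 1] ++ d1w 2 ++ delta3w 0) (d1w 0 ++ [:: X 1; M 0] ++ d1w 1).
Proof.
split; unfold_raw => H.
  words D in H; link by H.
by words D; link by H.
Qed.

Lemma first_left_comultiplicative_words :
  first_left_comultiplicative t1 <->
  weq D 6 ([:: X 2; X 3] ++ d1w 1 ++ [:: M 3] ++ delta3w 0) (d1w 0 ++ [:: X 1; X 2] ++ d1w 0 ++ [:: M 2]).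
Proof.
split; unfold_raw => H.
  words D in H; link by H.
by words D; link by H.
Qed.

Lemma first_left_counital_words :
  first_left_counital t1 e <->
  weq D 4 [:: E 1; M 1; M 0] (d1w 0 ++ [:: E 0; M 0]).
Proof.
split; unfold_raw => H.
  words D in H; link by H.
by words D; link by H.
Qed.

Lemma first_right_counital_words :
  first_right_counital t1 e <->
  weq D 4 [:: X 2; M 1; E 2; M 0] (d1w 0 ++ [:: X 1; M 0; E 1]).
Proof.
split; unfold_raw => H.
  words D in H; link by H.
by words D; link by H.
Qed.

End Halves.

(** * The equivalence for first components *)
Section HalfTheorem.
Variables (C : braided_category) (Q : epi_class C) (A : magma C).
Variables (t1 t2 : hom (A ⊗ A) (A ⊗ A)) (e : hom A munit).
Local Notation D := (Data t1 t2 e).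
Local Notation m := (mult A).

Definition commutation := on12 A t2 ∘ (idm A ⊠ t1) = (idm A ⊠ t1) ∘ on12 A t2.

Lemma commutation_words : commutation <-> weq D 3 [:: T 1; U 0] [:: U 0; T 1].
Proof.
rewrite /commutation /on12; split=> H; first by words D in H.
by words D.
Qed.

Lemma fusion_words : fusion_counit1 t1 e <->
  weq D 3 ([:: T 1] ++ lambdaw 0) [:: T 0; T 1] /\ weq D 2 [:: T 0; E 1] [:: E 1].
Proof.
rewrite /fusion_counit1 /on12; split=> -[H H']; split.
- by words D in H; link by (H, slides1 D).
- by words D in H'.
- by words D; link by (H, slides1 D).
- by words D.
Qed.

Lemma bimonoid_mult_words : bimonoid_mult t1 e = m <-> weq D 2 [:: T 0; E 0] [:: M 0].
Proof.
by rewrite /bimonoid_mult; split=> H; [words D in H|words D].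
Qed.

Lemma d1_epi_cancel w w' : inQ Q (d1 t1 m) ->
  weq D 5 (d1w 2 ++ w) (d1w 2 ++ w') -> weq D 4 w w'.
Proof.
have [u [Eu Ew]] := d1_words t1 t2 e; rewrite -Eu => Qd.
by have := @epi_cancel C Q D _ _ u 2 0 w w' Qd; rewrite Ew.
Qed.

Lemma M_epi_cancel w w' : inQ Q m ->
  weq D 6 (M 0 :: w) (M 0 :: w') -> weq D 5 w w'.
Proof. by move=> Qm; apply: (@epi_cancel C Q D _ _ (Ltr LM) 0 4). Qed.

Lemma E_epi_cancel w w' : inQ Q e ->
  weq D 3 (E 1 :: w) (E 1 :: w') -> weq D 2 w w'.
Proof. by move=> Qe; apply: (@epi_cancel C Q D _ _ (Ltr LE) 1 1). Qed.

(** The epimorphisms are used as follows: e to obtain e1.t1 = m, the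
    multiplication to obtain the fusion equation, and d1 to obtain the
    commutation of t1 with t2. *)
Theorem multiplier_half_of_comonoid :
  M_obj Q A -> inQ Q e -> inQ Q (d1 t1 m) -> is_Mmorphism (comult_pair t1 t2) ->
  counit_multiplicative e -> first_multiplicative t1 ->
  first_right_comultiplicative t1 -> first_left_counital t1 e -> first_right_counital t1 e ->
  [/\ fusion_counit1 t1 e, bimonoid_mult t1 e = m & commutation].
Proof.
move=> [sg [nd0 Qm]] Qe Qd /(comult_is_Mmorphism_words t1 t2 e) Hd.
move=> /(counit_multiplicative_words t1 t2) Hem /(first_multiplicative_words _ t2 e) Hmul.
move=> /(first_right_comultiplicative_words _ t2 e) Hr.
move=> /(first_left_counital_words _ t2) Hl /(first_right_counital_words _ t2) Hr'.
have asso : weq D 3 [:: M 0; M 0] [:: M 1; M 0] := is_semigroup_words t1 t2 e sg.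
have nd : nondegenerate (base D) := nd0.
have exch := exchange_of_Mmorphism asso nd Hd.
have mul := product_rule_of_d1 asso nd Hmul.
have tE : weq D 2 [:: T 0; E 0] [:: M 0].
  exact/weq_sym/(E_epi_cancel Qe)/(of_counit_left asso nd Hem Hl).
have f : weq D 3 ([:: T 1] ++ lambdaw 0) [:: T 0; T 1].
  (* The letters of right_comult_core around the core are removed: the product
     because m is in Q, the crossings because they are invertible. *)
  apply: (fusion_core_cancel nd) => //.
  apply: (@braid_cancel _ _ [:: X 2; X 1]) => //; apply: (M_epi_cancel Qm).
  apply: (@braid_cancel _ _ [:: X 0; X 2; X 1]) => //.
  apply: (weq_trans (weq_sym (right_comult_lhs asso nd exch))).
  exact: (weq_trans Hr (right_comult_rhs asso)).
split.
- exact/fusion_words/(conj f)/(of_counit_right asso nd Hr').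
- exact/bimonoid_mult_words.
- apply/commutation_words; apply: (commutation_of_mulmid nd).
  exact: (d1_epi_cancel Qd (commutation_times_d1 asso exch f mul)).
Qed.

Theorem half_of_multiplier :
  is_semigroup A -> nondegenerate A -> fusion_counit1 t1 e -> bimonoid_mult t1 e = m ->
  commutation -> runit A ∘ (idm A ⊠ e) ∘ t2 = m ->
  [/\ counit_multiplicative e, first_multiplicative t1, first_left_comultiplicative t1,
    first_right_comultiplicative t1 & first_left_counital t1 e /\ first_right_counital t1 e].
Proof.
move=> sg nd0 /fusion_words[f tE'] /bimonoid_mult_words tE /commutation_words comm H.
words D in H.
have exch : weq D 3 [:: T 1; M 0] [:: U 0; M 1] by apply: exchange_of_commutation.
have asso : weq D 3 [:: M 0; M 0] [:: M 1; M 0] := is_semigroup_words t1 t2 e sg.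
(* e.m = e.e1.t1 = e.1e.t1 = e.1e *)
have emul : weq D 2 [:: M 0; E 0] [:: E 0; E 0].
  via ([:: T 0; E 0; E 0]); first link by tE.
  link by tE'.
have nd : nondegenerate (base D) := nd0.
have mul := product_rule_of_fusion f tE.
split.
- by unfold_raw; words D.
- exact/(first_multiplicative_words _ t2 e)/d1_of_product_rule.
- exact/(first_left_comultiplicative_words _ t2 e)/left_comult.
- apply/(first_right_comultiplicative_words _ t2 e).
  apply: (weq_trans (right_comult_lhs asso nd exch)); apply: (weq_trans _ (weq_sym (right_comult_rhs asso))).
  link by f.
- split; first exact/(first_left_counital_words _ t2)/counit_left.
  exact/(first_right_counital_words _ t2)/counit_right.
Qed.

End HalfTheorem.

(** * Second components as first components of the reversed category *)
Section Mirror.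
Variables (C : braided_category) (Q : epi_class C) (A : magma C).

Definition mirror_magma : magma (mirror C) := @Magma (mirror C) A (mult A).

Lemma mirror_coequalizer X Y (f : @hom (mirror C) X Y) : inQ Q f ->
    exists (Z : mirror C) (p q : hom Z X),
      is_coequalizer p q f /\
      forall W : mirror C,
        is_coequalizer (idm W ⊠ p) (idm W ⊠ q) (idm W ⊠ f) /\
        is_coequalizer (p ⊠ idm W) (q ⊠ idm W) (f ⊠ idm W).
Proof.
move=> /Q_coequalizer[Z [p [q [E H]]]]; exists Z, p, q; split=> // W.
by have [] := H W.
Qed.

Definition mirror_Q : epi_class (mirror C) :=
  @EpiClass (mirror C) (@inQ C Q) (@Q_regular C Q) (@Q_iso C Q) (@Q_comp C Q)
    (fun _ _ _ _ f g Qf Qg => Q_tens Qg Qf) (@Q_cancel C Q) mirror_coequalizer.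

Lemma mirror_M_obj : M_obj Q A -> M_obj mirror_Q mirror_magma.
Proof.
move=> [sg [nd Qm]]; split; last first.
  by split=> // V W; split; [apply: (proj2 (nd V W))|apply: (proj1 (nd V W))].
rewrite /is_semigroup /= in sg *.
by rewrite sg -!compA associK compm1.
Qed.

Variables (t1 t2 : hom (A ⊗ A) (A ⊗ A)) (e : hom A munit).
Local Notation D := (Data t1 t2 e).
Local Notation m := (mult A).
Local Notation A' := mirror_magma.

Lemma d1_mirror : @d1 (mirror C) A' t2 (mult A') = d2 t2 m.
Proof. by unfold_raw; words D; link. Qed.

Lemma mirror_is_Mmorphism : is_Mmorphism (comult_pair t1 t2) ->
  is_Mmorphism (@comult_pair (mirror C) A' t2 t1).
Proof.
move=> /(comult_is_Mmorphism_words t1 t2 e) H; unfold_raw.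
apply/esym; words D; link by H.
Qed.

Definition second_multiplicative : Prop :=
  d2 t2 m ∘ (d2 t2 m ⊠ idm A) = d2 t2 m ∘ (idm (A ⊗ A) ⊠ m) ∘ assoc (A ⊗ A) A A.

Lemma mirror_multiplicative :
  second_multiplicative <-> @first_multiplicative (mirror C) A' t2.
Proof.
rewrite /second_multiplicative; split; unfold_raw => H.
  by words D in H; words D; link by H.
by words D in H; words D; link by H.
Qed.

Lemma mirror_counit_multiplicative :
  @counit_multiplicative (mirror C) A' e <-> counit_multiplicative e.
Proof.
by split; unfold_raw => H; words D in H; words D; link by H.
Qed.

Lemma mirror_commutation : commutation t1 t2 -> @commutation (mirror C) A' t2 t1.
Proof.
by rewrite /commutation; unfold_raw => H; words D in H; words D; link by H.
Qed.

Lemma mirror_fusion : @fusion_counit1 (mirror C) A t2 e <-> fusion_counit2 t2 e.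
Proof.
rewrite /fusion_counit1 /fusion_counit2 /on12 /=; split=> -[H H']; split=> //;
  by words D in H; words D; link by H.
Qed.

Definition snd_composite (A B D : C)
    (g : hom (D ⊗ B) D) (f : hom (B ⊗ A) B) (h : hom (D ⊗ A) D) : Prop :=
  h ∘ (g ⊠ idm A) = g ∘ (idm D ⊠ f) ∘ assoc D B A.

(** The second components of the iterated comultiplication. *)
Definition delta3' : hom (((A ⊗ A) ⊗ A) ⊗ A) ((A ⊗ A) ⊗ A) := @delta3 (mirror C) A' t2.
Definition delta3r : hom ((A ⊗ (A ⊗ A)) ⊗ A) (A ⊗ (A ⊗ A)) := @delta3l (mirror C) A' t2.

Local Notation prod2 f g W X Y Z := ((f ⊠ g) ∘ middle4 W X Y Z).

Lemma mirror_right_comultiplicative :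
  @first_right_comultiplicative (mirror C) A' t2 <->
  snd_composite (prod2 (d2 t2 m) m (A ⊗ A) A A A) (d2 t2 m) delta3'.
Proof.
rewrite /snd_composite /delta3'; split; unfold_raw => H;
  by words D in H; words D; link by H.
Qed.

Lemma mirror_left_comultiplicative :
  @first_left_comultiplicative (mirror C) A' t2 <->
  snd_composite (prod2 m (d2 t2 m) A (A ⊗ A) A A) (d2 t2 m) delta3r.
Proof.
rewrite /snd_composite /delta3r; split; unfold_raw => H;
  by words D in H; words D; link by H.
Qed.

Lemma mirror_right_counital :
  @first_right_counital (mirror C) A' t2 e <->
  snd_composite (prod2 (e ∘ lunit A) m munit A A A) (d2 t2 m)
    (luniti A ∘ m ∘ (lunit A ⊠ idm A)).
Proof.
rewrite /snd_composite; split; unfold_raw => H;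
  by words D in H; words D; link by H.
Qed.

Lemma mirror_left_counital :
  @first_left_counital (mirror C) A' t2 e <->
  snd_composite (prod2 m (e ∘ lunit A) A munit A A) (d2 t2 m)
    (runiti A ∘ m ∘ (runit A ⊠ idm A)).
Proof.
rewrite /snd_composite; split; unfold_raw => H;
  by words D in H; words D; link by H.
Qed.

End Mirror.

(** * Products of A with itself *)
Section TripleProducts.
Variables (C : braided_category) (D : bialgebra_data C).
Local Notation "w ≈[ n ] w'" := (weq D n w w') (at level 70).
Hypothesis asso : [:: M 0; M 0] ≈[3] [:: M 1; M 0].

(** Linearity in the triple (p, q, r) over the multiplication of the triple
    product, by which composing with the associativity of the category of
    M-morphisms amounts to composing with the associator. *)
Lemma delta3w_linear : [:: T 1; M 0] ≈[3] [:: U 0; M 1] -> nondegenerate (base D) ->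
  shift 1 mul3w ++ delta3w 0 ≈[7] delta3w 0 ++ mul3w.
Proof.
move=> exch nd; have lin := t1_linear asso nd exch.
have d1_linear : shift 1 (mul2w 0) ++ d1w 0 ≈[5] d1w 0 ++ mul2w 0.
  link by (lin, asso).
via (shift 1 mul3w ++ [:: Y 2; Y 1; T 0; X 1; X 2] ++ d1w 0).
  link by (delta3w_alt D).
via ([:: Y 2; Y 1; T 0; X 1; X 2] ++ d1w 0 ++ mul3w); last link by (delta3w_alt D).
have r_linear : [:: M 3; Y 2; Y 1; T 0; X 1; X 2] ≈[5] [:: Y 2; Y 1; T 0; X 1; X 2; M 3].
  link by lin.
via ([:: X 3; X 4] ++ mul2w 1 ++ [:: Y 2; Y 1; T 0; X 1; X 2; M 3] ++ d1w 0).
  link by r_linear.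
via ([:: X 3; X 4; Y 4; Y 3; Y 2; Y 1; T 0; X 1; X 2; X 3; X 4] ++ mul2w 1 ++ d1w 0 ++ [:: M 2]).
  link.
link by d1_linear.
Qed.

Hypothesis nondeg : nondegenerate (base D).
Lemma cancel_mul2 n p w w' :
  shift 2 w ++ mul2w 0 ≈[n.+2] shift 2 w' ++ mul2w 0 ->
  width w n = Some p.+2 -> width w' n = Some p.+2 -> w ≈[n] w'.
Proof.
move=> H Ew Ew'; apply: (cancel_mul_mid nondeg _ Ew Ew').
have wide v : width v n = Some p.+2 ->
    width (shift 1 v ++ [:: X 0; M 1]) n.+1 = Some p.+2.
  move/(width_shift 1)/width_cat => -> /=.
  by rewrite width_cons /letter_width /= subn2 addn2 /= width_cons /letter_width /= subn2 addn1.
apply: (cancel_mul nondeg _ (wide _ Ew) (wide _ Ew')).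
have step v : width v n = Some p.+2 ->
    shift 1 (shift 1 v ++ [:: X 0; M 1]) ++ [:: M 0] ≈[n.+2] shift 2 v ++ mul2w 0.
  move=> Ev; rewrite shift_cat shiftD -catA; apply: (weq_catl (width_shift 2 Ev)).
  by apply: (@weq_wider _ _ 4) => //; link.
apply: (weq_trans (step _ Ew)); apply: (weq_trans _ (weq_sym (step _ Ew'))).
exact: H.
Qed.

(** Nondegeneracy of the triple product, one factor at a time from the left. *)
Lemma cancel_mul3 n w w' :
  shift 3 w ++ mul3w ≈[n.+3] shift 3 w' ++ mul3w ->
  width w n = Some 3 -> width w' n = Some 3 -> w ≈[n] w'.
Proof.
move=> H Ew Ew'.
(* mul3w without the product of the first factors: the first of the three
   strands moves to the front, the other two are multiplied. *)
pose R : word := [:: X 1; X 0] ++ mul2w 1.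
have H1 : shift 2 w ++ R ≈[n.+2] shift 2 w' ++ R.
  have wide v : width v n = Some 3 -> width (shift 2 v ++ R) n.+2 = Some 3.
    by move/(width_shift 2)/width_cat => ->.
  apply: (cancel_mul nondeg _ (wide _ Ew) (wide _ Ew')).
  have step v : width v n = Some 3 ->
      shift 1 (shift 2 v ++ R) ++ [:: M 0] ≈[n.+3] shift 3 v ++ mul3w.
    move=> Ev; rewrite shift_cat shiftD -catA; apply: (weq_catl (width_shift 3 Ev)).
    by rewrite /R; link.
  apply: (weq_trans (step _ Ew)); apply: (weq_trans _ (weq_sym (step _ Ew'))).
  exact: H.
have H2 : w ++ [:: Y 0; Y 1] ≈[n] w' ++ [:: Y 0; Y 1].
  have wide v : width v n = Some 3 -> width (v ++ [:: Y 0; Y 1]) n = Some 3.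
    by move/width_cat => ->.
  apply: (cancel_mul2 _ (wide _ Ew) (wide _ Ew')).
  have step v : width v n = Some 3 ->
      shift 2 (v ++ [:: Y 0; Y 1]) ++ mul2w 0 ≈[n.+2] (shift 2 v ++ R) ++ [:: Y 0; Y 1].
    move=> Ev; rewrite shift_cat -!catA; apply: (weq_catl (width_shift 2 Ev)).
    by rewrite /R; link.
  apply: (weq_trans (step _ Ew)); apply: (weq_trans _ (weq_sym (step _ Ew'))).
  exact: weq_catr.
have back v : width v n = Some 3 -> v ≈[n] (v ++ [:: Y 0; Y 1]) ++ [:: X 1; X 0].
  move=> Ev; rewrite -catA -{1}(cats0 v); apply: (weq_catl Ev).
  link.
apply: (weq_trans (back _ Ew)); apply: (weq_trans _ (weq_sym (back _ Ew'))).
exact: weq_catr.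
Qed.

Lemma mul_cancel (V W : C) n (f g : hom V (pow D W n.+1)) :
  strict W (raw D LM) n ∘ (idm (base D) ⊠ f) = strict W (raw D LM) n ∘ (idm (base D) ⊠ g) ->
  f = g.
Proof. by rewrite strict_mul => /(proj2 (nondeg _ _)). Qed.

(** The factors of A ⊗ A are cancelled one at a time: the first acts directly,
    and the second after its partner has been moved to the front by Y. *)
Lemma mul2_cancel (V W : C) (f g : hom V (pow D W 2)) (q : hom (pow D W 4) (pow D W 2)) :
  run D W [:: X 1; M 2; M 0] 4 = arr q ->
  q ∘ (idm (base D) ⊠ (idm (base D) ⊠ f)) = q ∘ (idm (base D) ⊠ (idm (base D) ⊠ g)) ->
  f = g.
Proof.
have H3 : [:: X 0; M 1; Y 0] ≈[3] [:: Y 1; M 0] by link.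
pose k : hom (pow D W 3) (pow D W 2) :=
  (idm (base D) ⊠ strict W (raw D LM) 0) ∘ strict W (raw D LC) 1.
have -> : run D W [:: X 1; M 2; M 0] 4 = @arr C D W 4 2 (strict W (raw D LM) 1 ∘ (idm _ ⊠ k)).
  by rewrite /k /= /bind /= comp1m tens_compr compA.
have Ek : strict W (raw D LCi) 0 ∘ k = strict W (raw D LM) 1 ∘ (idm _ ⊠ strict W (raw D LCi) 0).
  apply: arr_inj; have := H3 W 0; rewrite addn0 /= /bind /= !comp1m => <-.
  by rewrite /k compA.
have split h : strict W (raw D LM) 1 ∘ (idm _ ⊠ k) ∘ (idm _ ⊠ (idm _ ⊠ h)) =
    strict W (raw D LM) 1 ∘ (idm _ ⊠ (k ∘ (idm (base D) ⊠ h))) :> hom (base D ⊗ (base D ⊗ V)) _.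
  by rewrite (@tens_compr C) compA.
move=> /arr_inj <-; rewrite !split => /mul_cancel E.
apply: (@split_mono_cancel _ _ _ _ (strict W (raw D LCi) 0) (strict W (raw D LC) 0)).
  by apply: arr_inj; have := @invYX C D W 0; rewrite addn0 /= /bind /= comp1m.
apply: (@mul_cancel _ W 1).
have join h : strict W (raw D LM) 1 ∘ (idm _ ⊠ (strict W (raw D LCi) 0 ∘ h)) =
    strict W (raw D LCi) 0 ∘ (k ∘ (idm (base D) ⊠ h)) :> hom (base D ⊗ V) _.
  by rewrite (@tens_compr C) compA -Ek; apply/esym/compA.
by rewrite !join E.
Qed.

Local Notation AA := (magma_tens (base D) (base D)).

Lemma tens_left_nondegenerate (V W : C) :
  injective (fun g : hom V (AA ⊗ W) =>
        (mult AA ⊠ idm W) ∘ associ AA AA W ∘ (idm AA ⊠ g)).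
Proof.
move=> f g E.
apply: (split_mono_cancel (assocK (base D) (base D) W)).
have [u [Eu Ew]] : exists u : mor (Pair (Pair At At) (Pair At At)) (Pair At At),
    mval D u = mult AA /\ mword u = [:: X 1; M 2; M 0].
  rewrite /= /middle4.
  match goal with |- exists u, mval ?D u = ?f /\ _ => let u := quote D f in exists u end.
  by split.
have Ev := run_mword D W u 0; rewrite Ew in Ev; apply: (mul2_cancel Ev); rewrite Eu.
have strE h : strict W (mult AA : hom (obj_of D (Pair (Pair At At) (Pair At At))) (obj_of D (Pair At At))) 0
      ∘ (idm (base D) ⊠ (idm (base D) ⊠ (assoc (base D) (base D) W ∘ h))) =
    assoc (base D) (base D) W ∘ ((mult AA ⊠ idm W) ∘ associ AA AA W ∘ (idm AA ⊠ h))
      ∘ associ (base D) (base D) V.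
  rewrite /strict [flat _ _ _ _]/= [flati _ _ _ _]/= !tensm1 !comp1m !compm1 -!compA.
  rewrite associ_nat tensm1 -[(associ (base D) (base D) W)]/(associ (base D) (base D) W).
  by rewrite [(idm AA ⊠ _) ∘ _]compA -tens_compr !compA assocK comp1m.
by rewrite [LHS]strE [RHS]strE E.
Qed.

Lemma is_semigroup_tens : is_semigroup AA.
Proof. by rewrite /is_semigroup /= /middle4; words D; link by asso. Qed.

End TripleProducts.

(** * Composites of M-morphisms *)
Section Composites.
Variables (C : braided_category) (Q : epi_class C).

Lemma is_iso_comp (V W E : C) (g : hom W E) (f : hom V W) :
  is_iso g -> is_iso f -> is_iso (g ∘ f).
Proof.
move=> [g' [g'g gg']] [f' [f'f ff']]; exists (f' ∘ g'); split.
  by rewrite -compA [g' ∘ _]compA g'g comp1m.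
by rewrite -compA [f ∘ _]compA ff' comp1m.
Qed.

Lemma is_iso_tens (V V' W W' : C) (f : hom V V') (g : hom W W') :
  is_iso f -> is_iso g -> is_iso (f ⊠ g).
Proof.
move=> [f' [f'f ff']] [g' [g'g gg']]; exists (f' ⊠ g').
by rewrite -!tensmM f'f ff' g'g gg' !tensm1.
Qed.

Lemma is_iso_id (V : C) : is_iso (idm V).
Proof. by exists (idm V); rewrite comp1m. Qed.

Lemma is_iso_assoc (V W E : C) : is_iso (assoc V W E).
Proof. by exists (associ V W E); rewrite assocK associK. Qed.

Lemma is_iso_associ (V W E : C) : is_iso (associ V W E).
Proof. by exists (assoc V W E); rewrite assocK associK. Qed.

Lemma is_iso_middle4 (V W V' W' : C) : is_iso (middle4 V W V' W').
Proof.
have braid_iso : is_iso (braid W V') by exists (braidi W V'); rewrite braidK braidiK.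
apply: is_iso_comp (is_iso_assoc _ _ _); apply: is_iso_comp (is_iso_associ _ _ _) _.
apply: is_iso_tens (is_iso_id _) _; apply: is_iso_comp (is_iso_associ _ _ _).
by apply: is_iso_comp (is_iso_assoc _ _ _) _; apply: is_iso_tens (is_iso_id _).
Qed.

Lemma Q_prod (V W V' W' V2 W2 : C) (f : hom (V ⊗ V') V2) (g : hom (W ⊗ W') W2) :
  inQ Q f -> inQ Q g -> inQ Q ((f ⊠ g) ∘ middle4 V W V' W').
Proof. by move=> Qf Qg; apply: Q_comp (Q_tens Qf Qg) (Q_iso Q (is_iso_middle4 _ _ _ _)). Qed.

Lemma fst_composite_unique (A B E : C) (g : hom (B ⊗ E) E) (f : hom (A ⊗ B) B) (h h' : hom (A ⊗ E) E) :
  inQ Q g -> fst_composite g f h -> fst_composite g f h' -> h = h'.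
Proof.
move=> Qg; rewrite /fst_composite => <- /(split_epi_cancel (associK _ _ _)) H.
exact/esym/(Q_epi (Q_tens (Q_id Q A) Qg) H).
Qed.

Lemma snd_composite_unique (A B E : C) (g : hom (E ⊗ B) E) (f : hom (B ⊗ A) B) (h h' : hom (E ⊗ A) E) :
  inQ Q g -> snd_composite g f h -> snd_composite g f h' -> h = h'.
Proof.
move=> Qg; rewrite /snd_composite => <- H.
exact/esym/(Q_epi (Q_tens Qg (Q_id Q A)) H).
Qed.

Lemma is_composite_spec (A B : C) (E : magma C) (g : components B E) (f : components A B)
    (h : components A E) : is_composite g f h ->
  [/\ is_Mmorphism h, fst_composite (fst_comp g) (fst_comp f) (fst_comp h)
    & snd_composite (snd_comp g) (snd_comp f) (snd_comp h)].
Proof. by case=> -[Hm [H1 H2]] _. Qed.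

(** Uniqueness of the composite holds because the components of g are
    epimorphisms, also after tensoring with A. *)
Lemma is_compositeI (A B : C) (E : magma C) (g : components B E) (f : components A B)
    (h : components A E) :
  inQ Q (fst_comp g) -> inQ Q (snd_comp g) -> is_Mmorphism h ->
  fst_composite (fst_comp g) (fst_comp f) (fst_comp h) ->
  snd_composite (snd_comp g) (snd_comp f) (snd_comp h) -> is_composite g f h.
Proof.
move=> Q1 Q2 Hm H1 H2; split=> // -[k1 k2] /= [_ [K1 K2]].
case: h Hm H1 H2 => h1 h2 /= _ H1 H2.
by rewrite (fst_composite_unique Q1 H1 K1) (snd_composite_unique Q2 H2 K2).
Qed.

Lemma Q_M_of_iso (A : C) (B : magma C) (f : hom A B) : inQ Q (mult B) -> is_iso f ->
  inQ Q (fst_comp (M_of_iso f)) /\ inQ Q (snd_comp (M_of_iso f)).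
Proof.
move=> Qm If; have Qf := Q_iso Q If.
by split; apply: Q_comp Qm _; [exact: Q_tens Qf (Q_id _ _)|exact: Q_tens (Q_id _ _) Qf].
Qed.

(** The case of the unit as the idle factor in nondegeneracy. *)
Lemma simple_right_nondegenerate (B : magma C) (V : C) (f g : hom V B) :
  nondegenerate B -> mult B ∘ (f ⊠ idm B) = mult B ∘ (g ⊠ idm B) -> f = g.
Proof.
move=> nd E; apply: (split_mono_cancel (lunitiK B)); apply: (proj1 (nd V munit)).
have step h : (idm munit ⊠ mult B) ∘ assoc munit B B ∘ ((luniti B ∘ h) ⊠ idm B)
    = luniti B ∘ (mult B ∘ (h ⊠ idm B)).
  apply: (split_mono_cancel (lunitK B)).
  rewrite !compA lunit_nat lunitiK comp1m -[mult B ∘ _ ∘ _]compA lunit_tens.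
  by rewrite -compA -tens_compl compA lunitiK comp1m.
by rewrite !step E.
Qed.

End Composites.

Lemma simple_left_nondegenerate (C : braided_category) (B : magma C) (V : C) (f g : hom V B) :
  nondegenerate B -> mult B ∘ (idm B ⊠ f) = mult B ∘ (idm B ⊠ g) -> f = g.
Proof.
move=> nd; apply: (@simple_right_nondegenerate (mirror C) (mirror_magma B)).
by move=> V' W'; split; [apply: (proj2 (nd V' W'))|apply: (proj1 (nd V' W'))].
Qed.

Section Unit.
Variables (C : braided_category) (Q : epi_class C).
Lemma M_obj_unit : M_obj Q (magma_unit : magma C).
Proof.
have unit_iso : is_iso (lunit (munit : C)).
  by exists (luniti munit); rewrite lunitK lunitiK.
split; last split; last exact: Q_iso.
- rewrite /is_semigroup /=.
  by rewrite -compA triangle -lunit_runit_munit.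
- move=> V W; split => f g /=.
    rewrite triangle -!tens_compl => /tens_munit_faithful.
    exact: (split_mono_cancel (runitK W)).
  have E : (lunit munit ⊠ idm W) ∘ associ munit munit W = idm munit ⊠ lunit W.
    by rewrite lunit_runit_munit -triangle -compA associK compm1.
  rewrite E -!tens_compr => /munit_tens_faithful.
  exact: (split_mono_cancel (lunitK W)).
Qed.
End Unit.

Section TensorSquare.
Variables (C : braided_category) (Q : epi_class C) (A : magma C).
Variables (t1 t2 : hom (A ⊗ A) (A ⊗ A)) (e : hom A munit).
Local Notation D := (Data t1 t2 e).

Lemma tens_mirror : mult (magma_tens (mirror_magma A) (mirror_magma A)) = mult (magma_tens A A).
Proof. by rewrite /= /middle4 /=; words D; link. Qed.

Lemma M_obj_tens : M_obj Q A -> M_obj Q (magma_tens A A).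
Proof.
move=> [sg [nd Qm]].
have asso : weq D 3 [:: M 0; M 0] [:: M 1; M 0] := is_semigroup_words t1 t2 e sg.
split; first exact: (is_semigroup_tens asso).
split; last exact: Q_prod.
move=> V W; split; last exact: (@tens_left_nondegenerate C D nd).
have nd' : nondegenerate (mirror_magma A).
  by move=> V' W'; split; [apply: (proj2 (nd V' W'))|apply: (proj1 (nd V' W'))].
have := @tens_left_nondegenerate (mirror C) (Data (base := mirror_magma A) t2 t1 e) nd' V W.
by rewrite [base _]/= tens_mirror.
Qed.
End TensorSquare.

(** * The iterated comultiplication *)
Section Explicit.
Variables (C : braided_category) (Q : epi_class C) (A : magma C).
Variables (t1 t2 : hom (A ⊗ A) (A ⊗ A)) (e : hom A munit).
Local Notation D := (Data t1 t2 e).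
Local Notation m := (mult A).

(** The composite through Δ ⊗ 1 and the passage to the other bracketing are
    given by the explicit first components already when d1 is multiplicative
    and (d1, d2) is an M-morphism. *)
Lemma explicit_composites :
  M_obj Q A -> is_Mmorphism (comult_pair t1 t2) -> first_multiplicative t1 ->
  first_left_comultiplicative t1 /\
  fst_composite (fst_comp (M_assoc A A A)) (delta3l t1) (delta3 t1).
Proof.
move=> [sg [nd0 _]] /(comult_is_Mmorphism_words t1 t2 e) Hd.
move=> /(first_multiplicative_words _ t2 e) Hmul.
have asso : weq D 3 [:: M 0; M 0] [:: M 1; M 0] := is_semigroup_words t1 t2 e sg.
have nd : nondegenerate (base D) := nd0.
have exch := exchange_of_Mmorphism asso nd Hd.
have mul := product_rule_of_d1 asso nd Hmul.
split; first exact/(first_left_comultiplicative_words _ t2 e)/left_comult.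
have lin := delta3w_linear asso exch nd.
by unfold_raw; words D; link by lin.
Qed.

Lemma explicit_Mmorphisms : is_semigroup A -> nondegenerate A -> commutation t1 t2 ->
  bimonoid_mult t1 e = m -> runit A ∘ (idm A ⊠ e) ∘ t2 = m ->
  [/\ is_Mmorphism (comult_pair t1 t2),
    is_Mmorphism (B := magma_tens (magma_tens A A) A) (Components (delta3l t1) (delta3' t2)) &
    is_Mmorphism (B := magma_tens A (magma_tens A A)) (Components (delta3 t1) (delta3r t2)) ].
Proof.
move=> sg nd0 /(commutation_words _ _ e) comm /(bimonoid_mult_words _ t2) tE H.
words D in H.
have exch : weq D 3 [:: T 1; M 0] [:: U 0; M 1] by apply: exchange_of_commutation.
have asso : weq D 3 [:: M 0; M 0] [:: M 1; M 0] := is_semigroup_words t1 t2 e sg.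
have D3m := delta3w_Mmorphism asso exch comm.
split.
- apply/(comult_is_Mmorphism_words t1 t2 e); exact: Mmorphism_of_exchange.
- by rewrite /delta3'; unfold_raw; words D; link by D3m.
- by rewrite /delta3r; unfold_raw; words D; link by D3m.
Qed.

End Explicit.

Section Coassoc.
Variables (C : braided_category) (Q : epi_class C) (A : magma C) (hA : M_obj Q A).
Variables (t1 t2 : hom (A ⊗ A) (A ⊗ A)) (e : hom A munit).
Local Notation D := (Data t1 t2 e).
Local Notation m := (mult A).
Local Notation A' := (mirror_magma A).
Local Notation prod f g W X Y Z := ((f ⊠ g) ∘ middle4 W X Y Z).
Local Notation d1 := (d1 t1 m).
Local Notation d2 := (d2 t2 m).
Hypothesis Q1 : inQ Q d1.
Hypothesis Q2 : inQ Q d2.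
Let Qm : inQ Q m := proj2 (proj2 hA).
Let sg : is_semigroup A := proj1 hA.
Let nd : nondegenerate A := proj1 (proj2 hA).

Lemma explicit_composites_mirror : is_Mmorphism (comult_pair t1 t2) -> second_multiplicative t2 ->
  snd_composite (prod m d2 A (A ⊗ A) A A) d2 (delta3r t2) /\
  snd_composite (snd_comp (M_assoc A A A)) (delta3' t2) (delta3r t2).
Proof.
move=> /(mirror_is_Mmorphism e) Hm /(mirror_multiplicative t1 t2 e) Hmul.
have [H H'] := @explicit_composites (mirror C) (mirror_Q Q) A' t2 t1 e (mirror_M_obj hA) Hm Hmul.
split; first exact/(mirror_left_comultiplicative t1 _ e).
move: H'; rewrite /snd_composite /delta3r /delta3'; unfold_raw => H'.
by words D in H'; words D; link by H'.
Qed.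

Lemma Q_M_assoc : inQ Q (fst_comp (M_assoc A A A)) /\ inQ Q (snd_comp (M_assoc A A A)).
Proof.
apply: (Q_M_of_iso (B := magma_tens A (magma_tens A A)) _ (is_iso_assoc _ _ _)).
by do 2!apply: Q_prod => //=.
Qed.

(** The second component of the composite through Δ ⊗ 1 is known only after a
    product with the left-hand triple, which is cancelled. *)
Lemma second_right_of_mul3 :
  snd_comp (M_assoc A A A) ∘ (idm _ ⊠ (delta3' t2 ∘ (prod d2 m (A ⊗ A) A A A ⊠ idm A))) =
  snd_comp (M_assoc A A A) ∘
    (idm _ ⊠ (prod d2 m (A ⊗ A) A A A ∘ (idm _ ⊠ d2) ∘ assoc _ _ _)) ->
  snd_composite (prod d2 m (A ⊗ A) A A A) d2 (delta3' t2).
Proof.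
rewrite /snd_composite /delta3'; unfold_raw => H; words D in H; words D.
have nd' : nondegenerate (base D) := nd.
by apply: (cancel_mul3 nd') => //; link by H.
Qed.

(** The given composites l and r must have the explicit components.  For the
    first component of l and the second of r this is uniqueness of composites;
    the first component of r then follows through the associativity, again by
    uniqueness, but from the equation for second components the second
    component of l can only be extracted by cancelling a product. *)
Lemma halves_of_coassociative :
  is_Mmorphism (comult_pair t1 t2) -> first_multiplicative t1 -> second_multiplicative t2 ->
  M_coassociative (comult_pair t1 t2) ->
  first_right_comultiplicative t1 /\ @first_right_comultiplicative (mirror C) A' t2.
Proof.
move=> Hm mul1 mul2 [l [r [Hl [Hr Ha]]]].
have [QA1 QA2] := Q_M_assoc.
have Ql1 : inQ Q (prod d1 m A A (A ⊗ A) A) by apply: Q_prod.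
have Ql2 : inQ Q (prod d2 m (A ⊗ A) A A A) by apply: Q_prod.
have Qr1 : inQ Q (prod m d1 A A A (A ⊗ A)) by apply: Q_prod.
have Qr2 : inQ Q (prod m d2 A (A ⊗ A) A A) by apply: Q_prod.
have [_ l1 l2] := is_composite_spec Hl.
have [_ r1 r2] := is_composite_spec Hr.
have [_ a1 a2] := is_composite_spec Ha.
have [L1 R1] := explicit_composites e hA Hm mul1.
have [R2 L2] := explicit_composites_mirror Hm mul2.
have El1 := fst_composite_unique Ql1 l1 L1.
have Er2 := snd_composite_unique Qr2 r2 R2.
rewrite El1 in a1; rewrite Er2 in a2.
have Er1 := fst_composite_unique QA1 a1 R1.
rewrite Er1 in r1; split=> //.
apply/(mirror_right_comultiplicative t1 t2 e); apply: second_right_of_mul3.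
move: L2; rewrite /snd_composite a2 => /(split_epi_cancel (associK _ _ _)) E.
have {}l2 : snd_comp l ∘ (prod d2 m (A ⊗ A) A A A ⊠ idm A) =
  prod d2 m (A ⊗ A) A A A ∘ (idm _ ⊠ d2) ∘ assoc _ _ _ by [].
by rewrite -l2 [idm _ ⊠ (delta3' _ ∘ _)](@tens_compr C) [idm _ ⊠ (snd_comp l ∘ _)](@tens_compr C) [LHS]compA [RHS]compA E.
Qed.

Lemma coassociative_of_halves :
  is_Mmorphism (comult_pair t1 t2) ->
  is_Mmorphism (B := magma_tens (magma_tens A A) A) (Components (delta3l t1) (delta3' t2)) ->
  is_Mmorphism (B := magma_tens A (magma_tens A A)) (Components (delta3 t1) (delta3r t2)) ->
  first_multiplicative t1 -> second_multiplicative t2 ->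
  first_right_comultiplicative t1 -> @first_right_comultiplicative (mirror C) A' t2 ->
  M_coassociative (comult_pair t1 t2).
Proof.
move=> Hm Hl Hr mul1 mul2 r1 /(mirror_right_comultiplicative t1 t2 e) l2.
have [QA1 QA2] := Q_M_assoc.
have [L1 R1] := explicit_composites e hA Hm mul1.
have [R2 L2] := explicit_composites_mirror Hm mul2.
exists (Components (delta3l t1) (delta3' t2)), (Components (delta3 t1) (delta3r t2)).
by split; [|split]; apply: (is_compositeI (Q := Q)) => //; apply: Q_prod.
Qed.

Lemma Q_counit : inQ Q (e ∘ runit A) <-> inQ Q e.
Proof.
split=> Qe; last by apply: Q_comp Qe (Q_iso _ _); exists (runiti A); rewrite runitK runitiK.
have -> : e = (e ∘ runit A) ∘ runiti A by rewrite -compA runitiK compm1.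
by apply: Q_comp Qe (Q_iso _ _); exists (runit A); rewrite runitK runitiK.
Qed.

End Coassoc.

(** * Counit laws and the theorem *)
Section CounitIso.
Variables (C : braided_category) (A : magma C) (P : C) (f : hom P A).
Hypotheses (sg : is_semigroup A) (nd : nondegenerate A).
Local Notation m := (mult A).

(** Composing h with an M-morphism that is induced by f means composing with f,
    when the result is the identity, whose components are m. *)
Lemma fst_composite_iso (h : hom (A ⊗ P) P) :
  fst_composite (m ∘ (f ⊠ idm A)) h m <-> f ∘ h = m ∘ (idm A ⊠ f).
Proof.
rewrite /fst_composite.
have -> : m ∘ (idm A ⊠ (m ∘ (f ⊠ idm A))) ∘ assoc A P A = m ∘ ((m ∘ (idm A ⊠ f)) ⊠ idm A).
  by rewrite tens_compr tens_compl !compA sg -!compA assoc_nat.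
rewrite -compA -tens_compl; split=> [|->] //.
by move/(simple_right_nondegenerate nd).
Qed.

Lemma snd_composite_iso (h : hom (P ⊗ A) P) :
  snd_composite (m ∘ (idm A ⊠ f)) h m <-> f ∘ h = m ∘ (f ⊠ idm A).
Proof.
rewrite /snd_composite.
have -> : m ∘ ((m ∘ (idm A ⊠ f)) ⊠ idm A) = m ∘ (idm A ⊠ (m ∘ (f ⊠ idm A))) ∘ assoc A P A.
  by rewrite tens_compr tens_compl !compA sg -!compA assoc_nat.
rewrite -[m ∘ _ ∘ (_ ⊠ h)]compA -tens_compr; split=> [|->] //.
by move/(split_epi_cancel (associK _ _ _))/(simple_left_nondegenerate nd).
Qed.
End CounitIso.

Section Counital.
Variables (C : braided_category) (Q : epi_class C) (A : magma C) (hA : M_obj Q A).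
Variables (t1 t2 : hom (A ⊗ A) (A ⊗ A)) (e : hom A munit).
Local Notation D := (Data t1 t2 e).
Local Notation m := (mult A).
Local Notation A' := (mirror_magma A).
Let Qm : inQ Q m := proj2 (proj2 hA).
Let sg : is_semigroup A := proj1 hA.
Let nd : nondegenerate A := proj1 (proj2 hA).

Lemma lunit_iso : is_iso (lunit A).
Proof. by exists (luniti A); rewrite lunitK lunitiK. Qed.
Lemma runit_iso : is_iso (runit A).
Proof. by exists (runiti A); rewrite runitK runitiK. Qed.

Lemma left_counital_halves : inQ Q e ->
  M_left_counital (comult_pair t1 t2) (counit_pair e) <->
  first_left_counital t1 e /\ @first_right_counital (mirror C) A' t2 e.
Proof.
move=> Qe; have [Qe1 Qe2] : inQ Q (e ∘ runit A) /\ inQ Q (e ∘ lunit A).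
  by split; apply: Q_comp Qe (Q_iso Q _); [exact: runit_iso|exact: lunit_iso].
have [Qu1 Qu2] := Q_M_of_iso (B := A) Qm lunit_iso.
split=> [[l [Hl Hu]]|[H1 /(mirror_right_counital t1 t2 e) H2]].
  have [_ l1 l2] := is_composite_spec Hl; have [_ u1 u2] := is_composite_spec Hu.
  split; [move: l1|apply/(mirror_right_counital t1 t2 e); move: l2].
    move: u1 => /(fst_composite_iso _ sg nd) u1.
    have -> // : fst_comp l = luniti A ∘ m ∘ (idm A ⊠ lunit A).
    by apply: (split_mono_cancel (lunitK A)); rewrite u1 !compA lunitiK comp1m.
  move: u2 => /(snd_composite_iso _ sg nd) u2.
  have -> // : snd_comp l = luniti A ∘ m ∘ (lunit A ⊠ idm A).
  by apply: (split_mono_cancel (lunitK A)); rewrite u2 !compA lunitiK comp1m.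
exists (Components (luniti A ∘ m ∘ (idm A ⊠ lunit A)) (luniti A ∘ m ∘ (lunit A ⊠ idm A))).
have asso : weq D 3 [:: M 0; M 0] [:: M 1; M 0] := is_semigroup_words t1 t2 e sg.
split; apply: (is_compositeI (Q := Q)) => //; try exact: Q_prod.
- by unfold_raw; words D; link by asso.
- by apply/(fst_composite_iso _ sg nd); rewrite !compA lunitiK comp1m.
- by apply/(snd_composite_iso _ sg nd); rewrite !compA lunitiK comp1m.
Qed.

Lemma right_counital_halves : inQ Q e ->
  M_right_counital (comult_pair t1 t2) (counit_pair e) <->
  first_right_counital t1 e /\ @first_left_counital (mirror C) A' t2 e.
Proof.
move=> Qe; have [Qe1 Qe2] : inQ Q (e ∘ runit A) /\ inQ Q (e ∘ lunit A).
  by split; apply: Q_comp Qe (Q_iso Q _); [exact: runit_iso|exact: lunit_iso].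
have [Qu1 Qu2] := Q_M_of_iso (B := A) Qm runit_iso.
split=> [[r [Hr Hu]]|[H1 /(mirror_left_counital t1 t2 e) H2]].
  have [_ r1 r2] := is_composite_spec Hr; have [_ u1 u2] := is_composite_spec Hu.
  split; [move: r1|apply/(mirror_left_counital t1 t2 e); move: r2].
    move: u1 => /(fst_composite_iso _ sg nd) u1.
    have -> // : fst_comp r = runiti A ∘ m ∘ (idm A ⊠ runit A).
    by apply: (split_mono_cancel (runitK A)); rewrite u1 !compA runitiK comp1m.
  move: u2 => /(snd_composite_iso _ sg nd) u2.
  have -> // : snd_comp r = runiti A ∘ m ∘ (runit A ⊠ idm A).
  by apply: (split_mono_cancel (runitK A)); rewrite u2 !compA runitiK comp1m.
exists (Components (runiti A ∘ m ∘ (idm A ⊠ runit A)) (runiti A ∘ m ∘ (runit A ⊠ idm A))).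
have asso : weq D 3 [:: M 0; M 0] [:: M 1; M 0] := is_semigroup_words t1 t2 e sg.
split; apply: (is_compositeI (Q := Q)) => //; try exact: Q_prod.
- by unfold_raw; words D; link by asso.
- by apply/(fst_composite_iso _ sg nd); rewrite !compA runitiK comp1m.
- by apply/(snd_composite_iso _ sg nd); rewrite !compA runitiK comp1m.
Qed.

Lemma counit_hom : M_hom Q (B := magma_unit) (counit_pair e) <->
  inQ Q e /\ counit_multiplicative e.
Proof.
split.
  move=> [_ [_ [_ [[Qe _] [H _]]]]]; split; first exact/Q_counit.
  by move: H => /= H; words D in H; unfold_raw; words D; link by H.
move=> [Qe H]; split=> //; split; first exact: M_obj_unit.
rewrite /counit_multiplicative in H; words D in H.
split; first by unfold_raw; words D; link.
split; last by split=> /=; words D; link by H.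
by split; apply: Q_comp Qe (Q_iso Q _); [exact: runit_iso|exact: lunit_iso].
Qed.

End Counital.

Theorem theorem5p1 (C : braided_category) (Q : epi_class C) (A : magma C)
    (hA : M_obj Q A)
    (t1 t2 : hom (tens A A) (tens A A)) (e : hom (carrier A) munit) :
  M_comonoid Q (comult_pair t1 t2) (counit_pair e) <->
  (is_multiplier_bimonoid t1 t2 e /\
   bimonoid_mult t1 e = mult A /\
   inQ Q e /\ inQ Q (d1 t1 (mult A)) /\ inQ Q (d2 t2 (mult A))).
Proof.
have [sg [nd Qm]] := hA.
have hA' := mirror_M_obj hA.
split.
  move=> [[_ [_ [Hm [[Q1 Q2] [mul1 mul2]]]]] [He [Hco [Hl Hr]]]].
  have [Qe Hem] := iffLR (counit_hom hA t1 t2 e) He.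
  have [co1 co2] := halves_of_coassociative hA e Q1 Q2 Hm mul1 mul2 Hco.
  have [l1 r2] := iffLR (left_counital_halves hA t1 t2 Qe) Hl.
  have [r1 l2] := iffLR (right_counital_halves hA t1 t2 Qe) Hr.
  have [f1 tE comm] := multiplier_half_of_comonoid hA Qe Q1 Hm Hem mul1 co1 l1 r1.
  have Hm' := mirror_is_Mmorphism e Hm.
  have Q2' : inQ (mirror_Q Q) (@d1 (mirror C) A t2 (mult (mirror_magma A))).
    by rewrite (d1_mirror t1 t2 e).
  have Hem' := iffRL (mirror_counit_multiplicative t1 t2 e) Hem.
  have mul2' := iffLR (mirror_multiplicative t1 t2 e) mul2.
  have [f2 uE _] := @multiplier_half_of_comonoid (mirror C) (mirror_Q Q)
    (mirror_magma A) t2 t1 e hA' Qe Q2' Hm' Hem' mul2' co2 l2 r2.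
  split=> //; split=> //; split; first exact/(mirror_fusion t1).
  by split=> //; exact: (etrans tE (esym uE)).
move=> [[f1 [f2 [comm EE]]] [tE [Qe [Q1 Q2]]]].
have uE : runit A ∘ (idm A ⊠ e) ∘ t2 = mult A by rewrite -EE.
have [Hm Hl Hr] := explicit_Mmorphisms sg nd comm tE uE.
have [Hem mul1 _ co1 [l1 r1]] := half_of_multiplier sg nd f1 tE comm uE.
have f2' := iffRL (mirror_fusion t1 t2 e) f2.
have [_ mul2' _ co2 [l2 r2]] := @half_of_multiplier (mirror C) (mirror_magma A) t2 t1 e
  (proj1 hA') (proj1 (proj2 hA')) f2' uE (mirror_commutation e comm) tE.
have mul2 := iffRL (mirror_multiplicative t1 t2 e) mul2'.
split; first by split=> //; split; first exact: (M_obj_tens t1 t2 e).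
split; first exact/(counit_hom hA).
split; first exact: (coassociative_of_halves hA e).
by split; [apply/(left_counital_halves hA)|apply/(right_counital_halves hA)].
Qed.
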